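(* Let $G$ be a Carnot group of step $s$. For any $\lambda > 0$, there exists a constant $C > 0$ depending only on $d_{HS}$, $\lambda$, and the Euclidean structure $|\cdot|$ so that the following holds. Let $p_1,p_2,p_3,p_4,p_5 \in G$ be points so that $\lambda \ell \leq d_{HS}(p_i,p_j) \leq \ell$ if $i \neq j$, for some $\ell > 0$. Then $$\sum_{k=1}^s \sup_{t \in [0,1]} \frac{d_{HS}(\pi_k(L_{p_3,p_4}(t)),\pi_k(\overline{p_1,p_5}))^{2k}}{\ell^{2k-1}} \leq C \Delta,$$ where $\Delta = \sum_{k=2}^s \Delta_k(p_1,p_2,p_3,p_4,p_5)$.
   Context: A Carnot group of step $s$ is a simply connected Lie group $G$ whose Lie algebra has a stratification $\mathfrak g = V_1\oplus\cdots\oplus V_s$ with $[V_1,V_j]=V_{j+1}$ for $j\ge 1$ (with $V_k=0$ for $k>s$ and $V_s\ne 0$). Via $\exp$ and a choice of bases of the $V_i$, $G$ is identified with $\mathbb R^n=\mathbb R^{n_1+\cdots+n_s}$, $n_i=\dim V_i$ (exponential coordinates $g=(g_1,\dots,g_s)$, identity $0$). The automorphisms $\delta_\lambda(g_1,\dots,g_s)=(\lambda g_1,\lambda^2 g_2,\dots,\lambda^s g_s)$ are the dilations ($\delta_0(g)=0$). For $1\le i\le s$, $\pi_i:G\to G/\exp(V_{i+1}\oplus\cdots\oplus V_s)$ is the quotient homomorphism, $\pi_i(g)=(g_1,\dots,g_i)$; $\pi_i(G)\cong\mathbb R^{n_1+\cdots+n_i}$ is again a Carnot group. Hebisch–Sikora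 norm: let $\|\cdot\|$ be the standard Euclidean norm in coordinates and fix a sufficiently small $\eta_*>0$; set $N_{HS}(g)=\inf\{\lambda>0:\|\delta_{1/\lambda}(g)\|<\eta_*\}$, on $G$ and (same formula, same $\eta_*$) on each $\pi_i(G)$. For $\eta_*$ small (by Hebisch–Sikora) these are all subadditive homogeneous norms, smooth away from $0$. Put $d_{HS}(g,h)=N_{HS}(g^{-1}h)$ on $G$ and on each $\pi_i(G)$, and $|\cdot|=\|\cdot\|/\eta_*$. Distance to a set is the infimum of distances. Let $\tilde\pi(g_1,\dots,g_s)=(g_1,0,\dots,0)$. For $g,h\in G$, $t\in[0,1]$, $L_{g,h}(t)=g\,\delta_t(\tilde\pi(g^{-1}h))$ and $\overline{g,h}=\{L_{g,h}(t):t\in[0,1]\}$. The triangle inequality excess is $$\Delta_i(p_1,\dots,p_k)=\sum_{j=1}^{k-1}d_{HS}(\pi_i(p_j),\pi_i(p_{j+1}))-d_{HS}(\pi_i(p_1),\pi_i(p_k)).$$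
   Formalization: The step s is assumed to be at least 2: for s = 1 the sum Δ is empty, so the right side is 0, while the left side is positive for example when p_3 and p_4 lie off the segment from p_1 to p_5 in the plane. *)

(* Defs.v *)
From mathcomp Require Import all_boot all_order all_algebra.
From mathcomp Require Import classical_sets reals.

Set Implicit Arguments.
Unset Strict Implicit.
Unset Printing Implicit Defensive.

Import Order.TTheory GRing.Theory Num.Theory.
Local Open Scope classical_set_scope.
Local Open Scope ring_scope.

(* The Baker-Campbell-Hausdorff formula in Dynkin's form, truncated to iterated
   brackets of length at most s, for a bracket br:
     log(e^x e^y) = \sum_(m >= 1) (-1)^(m-1) / m *
       \sum_(a_i + b_i > 0) [x^a_1 y^b_1 ... x^a_m y^b_m]
                            / ((\sum_i (a_i + b_i)) * \prod_i a_i! b_i!),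
   where [w_1 ... w_k] = [w_1, [w_2, ... [w_(k-1), w_k]]]; the exponent pair
   (a_i, b_i) is e i. *)
Section BCH.
Variables (R : realType) (V : lmodType R) (br : V -> V -> V).

Fixpoint iterated_bracket (w : seq V) : V :=
  match w with
  | [::] => 0
  | [:: v] => v
  | v :: w' => br v (iterated_bracket w')
  end.

Definition bch_word m s (e : {ffun 'I_m -> 'I_s.+1 * 'I_s.+1}) (x y : V) :=
  flatten [seq nseq (e i).1 x ++ nseq (e i).2 y | i <- enum 'I_m].

Definition bch_length m s (e : {ffun 'I_m -> 'I_s.+1 * 'I_s.+1}) : nat :=
  (\sum_i ((e i).1 + (e i).2))%N.

Definition bch (s : nat) (x y : V) : V :=
  \sum_(1 <= m < s.+1)
    \sum_(e : {ffun 'I_m -> 'I_s.+1 * 'I_s.+1}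
          | [forall i, (0 < (e i).1 + (e i).2)%N] && (bch_length e <= s)%N)
      ((-1) ^+ m.-1
        / (m * bch_length e * \prod_i ((e i).1`! * (e i).2`!))%:R)
      *: iterated_bracket (bch_word e x y).

End BCH.

(* [in_layer layer j x] : x lies in V_j, the span of the basis vectors of
   layer j. *)
Definition in_layer (R : realType) n (layer : 'I_n -> nat) (j : nat)
  (x : 'rV[R]_n) : Prop := forall i, layer i != j -> x 0 i = 0.

(* A Carnot group of step s in exponential coordinates with respect to a basis
   of the Lie algebra adapted to the stratification: the i-th basis vector
   belongs to V_(layer i). The Lie algebra, hence the group, is nilpotent, so
   for a simply connected group exp is a diffeomorphism; the coordinates
   identify the group with R^n and its product is given by the
   Baker-Campbell-Hausdorff formula. Conversely this product makes R^n a simply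
   connected Lie group with the given Lie algebra. *)
Record carnot_group (R : realType) (s : nat) := CarnotGroup {
  cdim : nat;
  layer : 'I_cdim -> nat;
  bracket : 'rV[R]_cdim -> 'rV[R]_cdim -> 'rV[R]_cdim;
  bracket_linearl : forall a x y z,
    bracket (a *: x + y) z = a *: bracket x z + bracket y z;
  bracket_linearr : forall a x y z,
    bracket z (a *: x + y) = a *: bracket z x + bracket z y;
  bracketxx : forall x, bracket x x = 0;
  bracket_jacobi : forall x y z,
    bracket x (bracket y z) + bracket y (bracket z x)
      + bracket z (bracket x y) = 0;
  layer_gt0 : forall i, (0 < layer i)%N;
  layer_le : forall i, (layer i <= s)%N;
  last_layer : exists i, layer i = s;
  (* [V_1, V_j] = V_(j+1), where [V_1, V_j] is the span of the brackets *)
  stratification : forall j, (0 < j)%N -> forall z,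
    in_layer layer j.+1 z <->
    exists m (x y : 'I_m -> 'rV[R]_cdim),
      (forall i, in_layer layer 1 (x i) /\ in_layer layer j (y i)) /\
      z = \sum_i bracket (x i) (y i);
  cmul : 'rV[R]_cdim -> 'rV[R]_cdim -> 'rV[R]_cdim;
  cmulE : forall x y, cmul x y = bch bracket s x y;
  cmulA : forall x y z, cmul x (cmul y z) = cmul (cmul x y) z;
  cmul0g : forall x, cmul 0 x = x;
  cmulg0 : forall x, cmul x 0 = x;
  cmulNg : forall x, cmul (- x) x = 0;
  cmulgN : forall x, cmul x (- x) = 0
}.

Section HebischSikora.
Variables (R : realType) (n : nat) (lay : 'I_n -> nat).

Definition enorm (x : 'rV[R]_n) : R := Num.sqrt (\sum_i x 0 i ^+ 2).

Definition dilation (l : R) (x : 'rV[R]_n) : 'rV[R]_n :=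
  \row_i (l ^+ lay i * x 0 i).

Definition hs_norm (eta : R) (x : 'rV[R]_n) : R :=
  inf [set l : R | 0 < l /\ enorm (dilation l^-1 x) < eta].

End HebischSikora.

Section CarnotGeometry.
Variables (R : realType) (s : nat) (G : carnot_group R s).
Local Notation point := 'rV[R]_(cdim G).

Definition hs_dist (eta : R) (g h : point) : R :=
  hs_norm (@layer _ _ G) eta (cmul (- g) h).

(* The quotient pi_k(G), with coordinates those of G of layer at most k. *)
Definition low (k : nat) : {set 'I_(cdim G)} := [set i | (layer i <= k)%N].

Definition qdim (k : nat) : nat := #|low k|.

Definition qlayer k (i : 'I_(qdim k)) : nat := layer (enum_val i).

Definition qproj k (g : point) : 'rV[R]_(qdim k) := \row_i g 0 (enum_val i).

(* the representative of a coset with vanishing coordinates in layers > k *)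
Definition qlift k (x : 'rV[R]_(qdim k)) : point :=
  \sum_i x 0 i *: delta_mx 0 (enum_val i).

Definition qmul k (x y : 'rV[R]_(qdim k)) : 'rV[R]_(qdim k) :=
  qproj k (cmul (qlift x) (qlift y)).

Definition qdist (eta : R) k (x y : 'rV[R]_(qdim k)) : R :=
  hs_norm (@qlayer k) eta (qmul (- x) y).

Definition qdist_set (eta : R) k (x : 'rV[R]_(qdim k))
  (A : set 'rV[R]_(qdim k)) : R := inf [set qdist eta x y | y in A].

Definition horizontal (g : point) : point :=
  \row_i (if layer i == 1%N then g 0 i else 0).

Definition hline (g h : point) (t : R) : point :=
  cmul g (dilation (@layer _ _ G) t (horizontal (cmul (- g) h))).

Definition hsegment (g h : point) : set point :=
  [set hline g h t | t in [set t : R | 0 <= t <= 1]].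

Definition excess (eta : R) (k : nat) (p : seq point) : R :=
  \sum_(j < (size p).-1) qdist eta (qproj k p`_j) (qproj k p`_j.+1)
  - qdist eta (qproj k p`_0) (qproj k p`_(size p).-1).

End CarnotGeometry.

(* Main.v *)
(* Only the excess in G itself is needed; the quotients contribute nonnegative
   terms. With [x = delta_(1/N g) g] and [y = delta_(1/N h) h], which lie in the
   Euclidean ball of radius [eta], and [t = N g / (N g + N h)],
   [delta_(1/(N g + N h)) (g h) = delta_t x delta_(1-t) y]. The squared Euclidean
   norm of this product is below the convex combination of those of x and y by at
   least [t (1 - t) / 2 * D], where D = |x_1 - y_1|^2 + \sum_(j >= 2) (|x_j|^2 + |y_j|^2):
   the first layer gives this by strict convexity, the higher ones because
   [t^j + (1-t)^j <= 1 - 2t(1-t)], and the commutator terms are [O(eta t (1-t) D)],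
   since [x', y'] = [x' - y', y'], hence negligible for small [eta].
   So a small excess forces consecutive increments to be almost horizontal
   and almost parallel. For points at comparable distances, everything then
   almost commutes: the element joining [L_(p1,p5)(r)] to [L_(p3,p4)(t)], with
   [r] the ratio of the lengths travelled, has coordinates [O(Delta^(1/2))],
   and [N_k^(2k)] is at most the square of that. *)

Require Import Defs.
From mathcomp Require Import all_boot all_order all_algebra.
From mathcomp Require Import classical_sets reals.
From mathcomp Require Import ring lra.

Set Implicit Arguments.
Unset Strict Implicit.
Unset Printing Implicit Defensive.

Import Order.TTheory GRing.Theory Num.Theory.
Local Open Scope classical_set_scope.
Local Open Scope ring_scope.

(** * Coordinate sums: the l1 norm and the squared Euclidean norm *)

Section SumNorm.
Variables (R : realType) (n : nat).
Implicit Types x y : 'rV[R]_n.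

(** Error terms are estimated in the l1 norm, which suits bilinear expansions; [sqsum] is the square
    of [enorm] and keeps membership in a Euclidean ball polynomial. *)
Definition l1norm x : R := \sum_i `|x 0 i|.
Definition sqsum x : R := \sum_i x 0 i ^+ 2.

Lemma l1norm_ge0 x : 0 <= l1norm x.
Proof. by apply: sumr_ge0 => i _. Qed.

Lemma sqsum_ge0 x : 0 <= sqsum x.
Proof. by apply: sumr_ge0 => i _; exact: sqr_ge0. Qed.

Lemma l1norm0 : l1norm 0 = 0.
Proof. by apply: big1 => i _; rewrite mxE normr0. Qed.

Lemma l1normD x y : l1norm (x + y) <= l1norm x + l1norm y.
Proof.
by rewrite -big_split /=; apply: ler_sum => i _; rewrite mxE ler_normD.
Qed.

Lemma l1normZ a x : l1norm (a *: x) = `|a| * l1norm x.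
Proof. by rewrite mulr_sumr; apply: eq_bigr => i _; rewrite mxE normrM. Qed.

Lemma l1normN x : l1norm (- x) = l1norm x.
Proof. by apply: eq_bigr => i _; rewrite mxE normrN. Qed.

Lemma l1norm_coord x i : `|x 0 i| <= l1norm x.
Proof.
rewrite /l1norm (bigD1 i) //= lerDl.
by apply: sumr_ge0 => j _.
Qed.

Lemma l1norm_le x d : (forall i, `|x 0 i| <= d) -> l1norm x <= n%:R * d.
Proof.
move=> xd; apply: (@le_trans _ _ (\sum_(i < n) d)); first exact: ler_sum.
by rewrite sumr_const card_ord mulr_natl.
Qed.

Lemma l1norm_sum (I : Type) (r : seq I) (P : pred I) (F : I -> 'rV[R]_n) :
  l1norm (\sum_(i <- r | P i) F i) <= \sum_(i <- r | P i) l1norm (F i).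
Proof.
elim/big_rec2 : _ => [|i u v _ uv]; first by rewrite l1norm0.
by apply: le_trans (l1normD _ _) _; rewrite lerD2l.
Qed.

Lemma sqsum_coord x i : x 0 i ^+ 2 <= sqsum x.
Proof.
rewrite /sqsum (bigD1 i) //= lerDl.
by apply: sumr_ge0 => j _; exact: sqr_ge0.
Qed.

Lemma sqsum_coord_le x d i : 0 <= d -> sqsum x <= d ^+ 2 -> `|x 0 i| <= d.
Proof.
move=> d0 xd.
rewrite -(ler_pXn2r (n := 2)) ?nnegrE// real_normK ?num_real//.
exact: le_trans (sqsum_coord x i) xd.
Qed.

Lemma sqsum_l1norm x d : 0 <= d -> sqsum x <= d ^+ 2 -> l1norm x <= n%:R * d.
Proof. by move=> d0 xd; apply: l1norm_le => i; exact: sqsum_coord_le. Qed.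

Lemma sqsum_le_l1norm x : sqsum x <= l1norm x ^+ 2.
Proof.
rewrite expr2 {1}/l1norm mulr_suml; apply: ler_sum => i _.
rewrite -[_ ^+ 2]real_normK ?num_real// expr2.
by apply: ler_wpM2l => //; exact: l1norm_coord.
Qed.

End SumNorm.

(** * The graded Lie bracket: bounds, layers, truncation *)

Section Bracket.
Variables (R : realType) (s : nat) (G : carnot_group R s).
Local Notation V := 'rV[R]_(cdim G).
Local Notation br := (@bracket R s G).
Local Notation lay := (@layer R s G).
Implicit Types x y z : V.

Lemma bracketDl x y z : br (x + y) z = br x z + br y z.
Proof. by rewrite -[x]scale1r bracket_linearl !scale1r. Qed.

Lemma bracketDr x y z : br z (x + y) = br z x + br z y.
Proof. by rewrite -[x]scale1r bracket_linearr !scale1r. Qed.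

Lemma bracket0l x : br 0 x = 0.
Proof. by apply: (addrI (br 0 x)); rewrite -bracketDl !addr0. Qed.

Lemma bracket0r x : br x 0 = 0.
Proof. by apply: (addrI (br x 0)); rewrite -bracketDr !addr0. Qed.

Lemma bracketZl a x y : br (a *: x) y = a *: br x y.
Proof. by rewrite -[a *: x]addr0 bracket_linearl bracket0l addr0. Qed.

Lemma bracketZr a x y : br y (a *: x) = a *: br y x.
Proof. by rewrite -[a *: x]addr0 bracket_linearr bracket0r addr0. Qed.

Lemma bracketC x y : br x y = - br y x.
Proof.
have := bracketxx (x + y); rewrite bracketDl !bracketDr !bracketxx add0r addr0.
by move/eqP; rewrite addr_eq0 => /eqP.
Qed.

(** With the next lemma, this is how smallness enters commutator bounds: the bracket of nearly
    equal, or nearly opposite, vectors is small. *)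
Lemma bracketBl_self x y : br x y = br (x - y) y.
Proof. by rewrite bracketDl -scaleN1r bracketZl bracketxx scaler0 addr0. Qed.

Lemma bracketDl_self x y : br x y = br (x + y) y.
Proof. by rewrite bracketDl bracketxx addr0. Qed.

Lemma bracket_suml (I : Type) (r : seq I) (P : pred I) (F : I -> V) y :
  br (\sum_(i <- r | P i) F i) y = \sum_(i <- r | P i) br (F i) y.
Proof.
apply: (big_morph (fun x => br x y)); last exact: bracket0l.
by move=> u v; rewrite bracketDl.
Qed.

Lemma bracket_sumr (I : Type) (r : seq I) (P : pred I) (F : I -> V) y :
  br y (\sum_(i <- r | P i) F i) = \sum_(i <- r | P i) br y (F i).
Proof.
apply: (big_morph (br y)); last exact: bracket0r.
by move=> u v; rewrite bracketDr.
Qed.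

Lemma bracket_coord x y :
  br x y = \sum_i \sum_j (x 0 i * y 0 j) *: br 'e_i 'e_j.
Proof.
rewrite {1}[x]row_sum_delta {1}[y]row_sum_delta bracket_suml.
apply: eq_bigr => i _; rewrite bracketZl bracket_sumr scaler_sumr.
by apply: eq_bigr => j _; rewrite bracketZr scalerA.
Qed.

(** By bilinearity, the sum of the norms of the brackets of basis vectors serves as the constant. *)
Lemma bracket_bounded :
  exists2 K : R, 0 <= K & forall x y, l1norm (br x y) <= K * l1norm x * l1norm y.
Proof.
exists (\sum_i \sum_j l1norm (br 'e_i 'e_j)).
  by do 2!(apply: sumr_ge0 => ? _); exact: l1norm_ge0.
move=> x y; rewrite bracket_coord.
apply: le_trans (l1norm_sum _ _ _) _; rewrite !mulr_suml; apply: ler_sum => i _.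
apply: le_trans (l1norm_sum _ _ _) _; rewrite !mulr_suml; apply: ler_sum => j _.
rewrite l1normZ normrM mulrC -mulrA.
apply: ler_wpM2l; first exact: l1norm_ge0.
by apply: ler_pM => //; exact: l1norm_coord.
Qed.

Lemma in_layer_sum j (I : Type) (r : seq I) (P : pred I) (F : I -> V) :
  (forall i, in_layer lay j (F i)) ->
  in_layer lay j (\sum_(i <- r | P i) F i).
Proof.
by move=> Fj i ij; rewrite summxE big1 // => k _; exact: Fj.
Qed.

Lemma in_layerN j x : in_layer lay j x -> in_layer lay j (- x).
Proof. by move=> xj i ij; rewrite mxE xj // oppr0. Qed.

Lemma in_layerD j x y :
  in_layer lay j x -> in_layer lay j y -> in_layer lay j (x + y).
Proof. by move=> xj yj i ij; rewrite mxE xj // yj // addr0. Qed.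

Lemma bracket_layer1 j x y : (0 < j)%N -> in_layer lay 1 x ->
  in_layer lay j y -> in_layer lay j.+1 (br x y).
Proof.
move=> j0 x1 yj; apply/(stratification j0).
by exists 1%N, (fun=> x), (fun=> y); split => //; rewrite big_ord1.
Qed.

(* [V_i] is generated from [V_1] by brackets, so the Jacobi identity
   reduces [V_i, V_j] to brackets with [V_1]. *)
Lemma bracket_layer i j x y : (0 < i)%N -> (0 < j)%N ->
  in_layer lay i x -> in_layer lay j y -> in_layer lay (i + j) (br x y).
Proof.
case: i => // i _; elim: i j x y => [|i IH] j x y j0; first exact: bracket_layer1.
move=> /(stratification (ltn0Sn i))[m [a [b [ab ->]]]] yj.
rewrite bracket_suml; apply: in_layer_sum => k.
have [ak bk] := ab k.
have -> : br (br (a k) (b k)) y =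
    br (a k) (br (b k) y) - br (b k) (br (a k) y).
  rewrite bracketC; apply/eqP; rewrite eq_sym -subr_eq0 opprK.
  have := bracket_jacobi (a k) (b k) y.
  rewrite (bracketC y (a k)) -scaleN1r bracketZr scaleN1r => <-.
  by [].
apply: in_layerD.
  rewrite addSn; apply: bracket_layer1 => //; exact: IH.
rewrite addSnnS; apply/in_layerN/IH => //; exact: bracket_layer1.
Qed.

Lemma in_layer_delta i : in_layer lay (lay i) ('e_i : V).
Proof. by move=> j; rewrite mxE /=; case: (eqVneq j i) => // ->; rewrite eqxx. Qed.

Lemma bracket_delta_eq0 i j k : lay k != (lay i + lay j)%N ->
  br 'e_i 'e_j 0 k = 0.
Proof.
have ei := @in_layer_delta i; have ej := @in_layer_delta j.
move=> kij; exact: (bracket_layer (layer_gt0 i) (layer_gt0 j) ei ej kij).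
Qed.

(** The grading kills all other pairs. Compatibility with dilations and truncations, and the
    vanishing in the first layer, are all read off from this expansion. *)
Lemma bracket_entry x y k : br x y 0 k =
  \sum_i \sum_(j | lay k == (lay i + lay j)%N)
     x 0 i * y 0 j * br 'e_i 'e_j 0 k.
Proof.
rewrite bracket_coord summxE; apply: eq_bigr => i _; rewrite summxE.
rewrite [RHS]big_mkcond; apply: eq_bigr => j _; rewrite mxE /=.
by case: eqP => // /eqP /bracket_delta_eq0 ->; rewrite mulr0.
Qed.

Lemma bracket_first_layer x y k : lay k = 1%N -> br x y 0 k = 0.
Proof.
move=> k1; rewrite bracket_entry big1 // => i _; rewrite big1 // => j.
rewrite k1; have := layer_gt0 i; have := layer_gt0 j.
by case: (lay i) (lay j) => [|a] [|b] //; rewrite addSn addnS.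
Qed.

Lemma dilation_bracket l x y :
  dilation lay l (br x y) = br (dilation lay l x) (dilation lay l y).
Proof.
apply/rowP => k; rewrite mxE !bracket_entry mulr_sumr; apply: eq_bigr => i _.
rewrite mulr_sumr; apply: eq_bigr => j /eqP ->; rewrite !mxE exprD; ring.
Qed.

(** Model of [qproj k] that stays inside the coordinates of [G], so that the quotients need no
    separate index type. *)
Definition trunc (k : nat) x : V := \row_i (if (lay i <= k)%N then x 0 i else 0).

Lemma truncK k x : trunc k (trunc k x) = trunc k x.
Proof. by apply/rowP => i; rewrite !mxE; case: (_ <= _)%N. Qed.

Lemma trunc_bracket k x y : trunc k (br x y) = trunc k (br (trunc k x) (trunc k y)).
Proof.
apply/rowP => c; rewrite !mxE; case: ifP => // ck; rewrite !bracket_entry.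
apply: eq_bigr => i _; apply: eq_bigr => j /eqP cij; rewrite !mxE.
have -> : (lay i <= k)%N by apply: leq_trans ck; rewrite cij leq_addr.
have -> // : (lay j <= k)%N by apply: leq_trans ck; rewrite cij leq_addl.
Qed.

End Bracket.

(** * The Baker-Campbell-Hausdorff product: commutator error, dilations, truncations *)

Section GroupLaw.
Variables (R : realType) (s : nat) (G : carnot_group R s).
Local Notation V := 'rV[R]_(cdim G).
Local Notation br := (@bracket R s G).
Local Notation lay := (@layer R s G).
Implicit Types (x y : V) (w : seq bool).

(** Words are lists of booleans, so that one word can be evaluated at several pairs: [(x, y)],
    [(x, 0)], [(0, y)], or dilated and truncated ones. *)
Definition bword w x y : V :=
  iterated_bracket br [seq if b then x else y | b <- w].

Lemma bword_cons2 b b' w x y :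
  bword [:: b, b' & w] x y = br (if b then x else y) (bword (b' :: w) x y).
Proof. by []. Qed.

Definition bch_exponents m := {ffun 'I_m -> 'I_s.+1 * 'I_s.+1}.

Definition bch_bools m (e : bch_exponents m) : seq bool :=
  flatten [seq nseq (e i).1 true ++ nseq (e i).2 false | i <- enum 'I_m].

Lemma bch_bword m (e : bch_exponents m) x y :
  iterated_bracket br (bch_word e x y) = bword (bch_bools e) x y.
Proof.
rewrite /bword /bch_bools /bch_word map_flatten -map_comp; congr iterated_bracket.
by congr flatten; apply: eq_map => i /=; rewrite map_cat !map_nseq.
Qed.

Definition bch_exponents_ok m (e : bch_exponents m) : bool :=
  [forall i, (0 < (e i).1 + (e i).2)%N] && (bch_length e <= s)%N.

Definition bch_coef m (e : bch_exponents m) : R :=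
  (-1) ^+ m.-1 / (m * bch_length e * \prod_i ((e i).1`! * (e i).2`!))%:R.

(* Subtracting the two one-variable words removes exactly the words of length
   one; longer ones vanish when a variable is 0. *)
Definition mixed w x y : V := bword w x y - bword w x 0 - bword w 0 y.

Lemma cmul_bword x y : cmul x y =
  \sum_(1 <= m < s.+1) \sum_(e : bch_exponents m | bch_exponents_ok e)
    bch_coef e *: bword (bch_bools e) x y.
Proof.
rewrite cmulE /bch; apply: eq_bigr => m _; apply: eq_bigr => e _.
by rewrite bch_bword.
Qed.

(** The linear part of the series need not be computed: [x] and [y] are rewritten as [cmul x 0] and
    [cmul 0 y] and expanded by the same series. *)
Lemma cmul_mixed x y : cmul x y - x - y =
  \sum_(1 <= m < s.+1) \sum_(e : bch_exponents m | bch_exponents_ok e)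
    bch_coef e *: mixed (bch_bools e) x y.
Proof.
rewrite -{2}(cmulg0 x) -{2}(cmul0g y) !cmul_bword.
rewrite -!sumrB; apply: eq_bigr => m _; rewrite -!sumrB.
by apply: eq_bigr => e _; rewrite -!scalerBr.
Qed.

(** The innermost bracket is zero or [br x y] up to sign, and each further letter costs a factor
    [K * M]. *)
Lemma bword_bounded w (M : R) : (1 < size w)%N -> 0 <= M ->
  exists2 C : R, 0 <= C & forall x y, l1norm x <= M -> l1norm y <= M ->
    l1norm (bword w x y) <= C * l1norm (br x y).
Proof.
case: w => [|b [|b' w]] //= _ M0.
elim: w b b' => [|b'' w IH] b b'.
  exists 1 => // x y _ _; rewrite mul1r /bword /=.
  case: b b' => [] [] //=; rewrite ?bracketxx ?l1norm0 ?l1norm_ge0//.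
  by rewrite bracketC l1normN.
have [C C0 HC] := IH b' b''; have [K K0 HK] := bracket_bounded G.
exists (K * M * C); first by rewrite !mulr_ge0.
move=> x y xM yM; rewrite bword_cons2; apply: le_trans (HK _ _) _.
rewrite -(mulrA (K * M)); apply: ler_pM; rewrite ?mulr_ge0 ?l1norm_ge0//.
  by apply: ler_wpM2l => //; case: b.
exact: HC.
Qed.

Lemma mixed_bounded w (M : R) : 0 <= M ->
  exists2 C : R, 0 <= C & forall x y, l1norm x <= M -> l1norm y <= M ->
    l1norm (mixed w x y) <= C * l1norm (br x y).
Proof.
move=> M0; case: (ltnP 1 (size w)) => [w1|].
  have [C C0 HC] := bword_bounded w1 M0; exists C => // x y xM yM.
  rewrite /mixed.
  have -> : bword w x 0 = 0.
    apply/rowP => i; rewrite mxE; apply/eqP; rewrite -normr_le0.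
    apply: le_trans (l1norm_coord _ _) _.
    by have := HC x 0 xM; rewrite bracket0r l1norm0 mulr0; apply.
  have -> : bword w 0 y = 0.
    apply/rowP => i; rewrite mxE; apply/eqP; rewrite -normr_le0.
    apply: le_trans (l1norm_coord _ _) _.
    by have := HC 0 y _ yM; rewrite bracket0l l1norm0 mulr0; apply.
  by rewrite !subr0; exact: HC.
case: w => [|b [|//]] _; exists 0 => // x y _ _; rewrite mul0r /mixed /bword /=.
  by rewrite !subr0 l1norm0.
by case: b; rewrite ?subr0 ?subrr ?sub0r ?oppr0 ?l1norm0 // subrr l1norm0.
Qed.

Lemma sum_bounded (I : Type) (r : seq I) (P : pred I) (F : I -> V -> V -> V)
    (M : R) :
  (forall i, exists2 C : R, 0 <= C & forall x y, l1norm x <= M ->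
     l1norm y <= M -> l1norm (F i x y) <= C * l1norm (br x y)) ->
  exists2 C : R, 0 <= C & forall x y, l1norm x <= M -> l1norm y <= M ->
     l1norm (\sum_(i <- r | P i) F i x y) <= C * l1norm (br x y).
Proof.
move=> HF; elim: r => [|i r [C C0 HC]].
  by exists 0 => // x y _ _; rewrite big_nil l1norm0 mul0r.
have [D D0 HD] := HF i; exists (D + C); first exact: addr_ge0.
move=> x y xM yM; rewrite big_cons mulrDl; case: ifP => _.
  by apply: le_trans (l1normD _ _) _; apply: lerD; [exact: HD|exact: HC].
apply: le_trans (HC _ _ xM yM) _; rewrite lerDr mulr_ge0 ?l1norm_ge0//.
Qed.

(** Bounding the error by [br x y] itself, rather than by the product of the norms, makes it small
    as soon as the factors are almost parallel. *)
Lemma cmul_bounded (M : R) : 0 <= M ->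
  exists2 C : R, 0 <= C & forall x y, l1norm x <= M -> l1norm y <= M ->
    l1norm (cmul x y - x - y) <= C * l1norm (br x y).
Proof.
move=> M0.
have [|C C0 HC] := @sum_bounded _ (index_iota 1 s.+1) xpredT
  (fun m x y => \sum_(e : bch_exponents m | bch_exponents_ok e)
    bch_coef e *: mixed (bch_bools e) x y) M.
  move=> m; apply: sum_bounded => e.
  have [C C0 HC] := mixed_bounded (bch_bools e) M0.
  exists (`|bch_coef e| * C); first exact: mulr_ge0.
  move=> x y xM yM; rewrite l1normZ -mulrA; apply: ler_wpM2l => //; exact: HC.
by exists C => // x y xM yM; rewrite cmul_mixed; exact: HC.
Qed.

Lemma bword_first_layer w x y k : lay k = 1%N -> (1 < size w)%N ->
  bword w x y 0 k = 0.
Proof. by case: w => [|b [|b' w]] // k1 _; exact: bracket_first_layer. Qed.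

Lemma cmul_first_layer x y k : lay k = 1%N -> cmul x y 0 k = x 0 k + y 0 k.
Proof.
move=> k1; suff : (cmul x y - x - y) 0 k = 0.
  by rewrite !mxE => /eqP; rewrite -addrA -opprD subr_eq0 => /eqP.
rewrite cmul_mixed summxE big1 // => m _; rewrite summxE big1 // => e _.
rewrite mxE /mixed.
case: (ltnP 1 (size (bch_bools e))) => [w1|].
  by rewrite !mxE !bword_first_layer // !subr0 mulr0.
case: (bch_bools e) => [|[] [|//]] _; rewrite /bword /= !mxE; ring.
Qed.

Lemma dilation_sum l (I : Type) (r : seq I) (P : pred I) (F : I -> V) :
  dilation lay l (\sum_(i <- r | P i) F i) =
  \sum_(i <- r | P i) dilation lay l (F i).
Proof.
by apply/rowP => i; rewrite !mxE !summxE mulr_sumr; apply: eq_bigr => j _; rewrite mxE.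
Qed.

Lemma dilationZ l a x : dilation lay l (a *: x) = a *: dilation lay l x.
Proof. by apply/rowP => i; rewrite !mxE mulrCA. Qed.

Lemma dilationN l x : dilation lay l (- x) = - dilation lay l x.
Proof. by apply/rowP => i; rewrite !mxE mulrN. Qed.

Lemma dilation_bword l w x y :
  dilation lay l (bword w x y) = bword w (dilation lay l x) (dilation lay l y).
Proof.
case: w => [|b w]; first by apply/rowP => i; rewrite !mxE mulr0.
elim: w b => [|b' w IH] b; first by case: b.
by rewrite !bword_cons2 dilation_bracket IH; case: b.
Qed.

Lemma dilation_cmul l x y :
  dilation lay l (cmul x y) = cmul (dilation lay l x) (dilation lay l y).
Proof.
rewrite !cmul_bword dilation_sum; apply: eq_bigr => m _.
rewrite dilation_sum; apply: eq_bigr => e _.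
by rewrite dilationZ dilation_bword.
Qed.

Lemma trunc_sum k (I : Type) (r : seq I) (P : pred I) (F : I -> V) :
  trunc k (\sum_(i <- r | P i) F i) = \sum_(i <- r | P i) trunc k (F i).
Proof.
apply/rowP => i; rewrite !mxE !summxE; case: ifP => ik.
  by apply: eq_bigr => j _; rewrite mxE ik.
by rewrite big1 // => j _; rewrite mxE ik.
Qed.

Lemma truncZ k a x : trunc k (a *: x) = a *: trunc k x.
Proof. by apply/rowP => i; rewrite !mxE; case: ifP; rewrite ?mulr0. Qed.

Lemma truncN k x : trunc k (- x) = - trunc k x.
Proof. by apply/rowP => i; rewrite !mxE; case: ifP; rewrite ?oppr0. Qed.

Lemma trunc_bword k w x y :
  trunc k (bword w x y) = trunc k (bword w (trunc k x) (trunc k y)).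
Proof.
case: w => [//|b w].
elim: w b => [|b' w IH] b; first by case: b; rewrite /bword /= truncK.
rewrite !bword_cons2 [LHS]trunc_bracket IH [RHS]trunc_bracket.
by case: b; rewrite truncK.
Qed.

(** Layers only add up under brackets, so layers above [k] never reach those up to [k]: truncation
    plays the role of the quotient homomorphism. *)
Lemma trunc_cmul k x y : trunc k (cmul x y) = trunc k (cmul (trunc k x) (trunc k y)).
Proof.
rewrite !cmul_bword !trunc_sum; apply: eq_bigr => m _.
rewrite !trunc_sum; apply: eq_bigr => e _.
by rewrite !truncZ trunc_bword.
Qed.

Lemma cmulVK x y : cmul (- x) (cmul x y) = y.
Proof. by rewrite cmulA cmulNg cmul0g. Qed.

Lemma cmulKV x y : cmul x (cmul (- x) y) = y.
Proof. by rewrite cmulA cmulgN cmul0g. Qed.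

Lemma oppr_cmul x y : - cmul x y = cmul (- y) (- x).
Proof.
rewrite -[RHS]cmulg0 -(cmulgN (cmul x y)) [RHS]cmulA -(cmulA (- y)) cmulVK.
by rewrite cmulNg cmul0g.
Qed.

Lemma cmul_chain x y z : cmul (cmul (- x) y) (cmul (- y) z) = cmul (- x) z.
Proof. by rewrite -cmulA cmulKV. Qed.

End GroupLaw.

Ltac nonneg := repeat first
  [ done | exact: ltW | exact: sqr_ge0 | exact: l1norm_ge0 | exact: sqsum_ge0
  | apply: mulr_ge0 | apply: addr_ge0 | apply: exprn_ge0 ].

(** * Uniform convexity of small Euclidean balls under the group product *)

Section Convexity.
Variables (R : realType) (s : nat) (G : carnot_group R s).
Local Notation V := 'rV[R]_(cdim G).
Local Notation br := (@bracket R s G).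
Local Notation lay := (@layer R s G).
Local Notation dil := (dilation lay).
Local Notation n := (cdim G).
Implicit Types x y : V.

(** The quantity D of the convexity estimate. It vanishes exactly when [x] and [y] are horizontal
    and equal. *)
Definition misalign x y : R :=
  \sum_i (if lay i == 1%N then (x 0 i - y 0 i) ^+ 2 else x 0 i ^+ 2 + y 0 i ^+ 2).

Lemma misalign_ge0 x y : 0 <= misalign x y.
Proof.
by apply: sumr_ge0 => i _; case: ifP => _; rewrite ?addr_ge0 ?sqr_ge0.
Qed.

Lemma misalign_coord x y i :
  (if lay i == 1%N then (x 0 i - y 0 i) ^+ 2 else x 0 i ^+ 2 + y 0 i ^+ 2)
    <= misalign x y.
Proof.
rewrite /misalign [leRHS](bigD1 i) //= lerDl; apply: sumr_ge0 => j _.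
by case: ifP => _; rewrite ?addr_ge0 ?sqr_ge0.
Qed.

Lemma horizontal_diff x y d : 0 <= d -> misalign x y <= d ^+ 2 ->
  l1norm (horizontal x - horizontal y) <= n%:R * d.
Proof.
move=> d0 xyd; apply: l1norm_le => i; rewrite !mxE.
have := le_trans (misalign_coord x y i) xyd.
case: ifP => _ h; last by rewrite subrr normr0.
by rewrite -(ler_pXn2r (n := 2)) ?nnegrE// real_normK ?num_real.
Qed.

Lemma vertical_bound x y d : 0 <= d -> misalign x y <= d ^+ 2 ->
  l1norm (x - horizontal x) <= n%:R * d.
Proof.
move=> d0 xyd; apply: l1norm_le => i; rewrite !mxE.
have := le_trans (misalign_coord x y i) xyd.
case: ifP => _ h; first by rewrite subrr normr0.
rewrite subr0 -(ler_pXn2r (n := 2)) ?nnegrE// real_normK ?num_real//.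
by apply: le_trans h; rewrite lerDl sqr_ge0.
Qed.

Definition l1misalign x y : R :=
  \sum_i (if lay i == 1%N then `|x 0 i - y 0 i| else `|x 0 i| + `|y 0 i|).

Lemma l1misalign_coord x y i :
  (if lay i == 1%N then `|x 0 i - y 0 i| else `|x 0 i| + `|y 0 i|)
    <= l1misalign x y.
Proof.
rewrite /l1misalign [leRHS](bigD1 i) //= lerDl; apply: sumr_ge0 => j _.
by case: ifP => _; rewrite ?addr_ge0.
Qed.

Lemma l1misalign_ge0 x y : 0 <= l1misalign x y.
Proof. by apply: sumr_ge0 => i _; case: ifP => _; rewrite ?addr_ge0. Qed.

Lemma l1misalign_sqr x y :
  l1misalign x y ^+ 2 <= 2 * n%:R ^+ 2 * misalign x y.
Proof.
have m0 := misalign_ge0 x y.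
(* Each of the [n] summands is at most [d]; the factor 2 comes from (|a| + |b|)^2 <= 2 (a^2 + b^2)
   in the higher layers. *)
pose d := Num.sqrt (2 * misalign x y).
have d2 : d ^+ 2 = 2 * misalign x y by rewrite sqr_sqrtr// mulr_ge0.
have -> : 2 * n%:R ^+ 2 * misalign x y = (n%:R * d) ^+ 2.
  by rewrite exprMn d2; ring.
rewrite ler_pXn2r ?nnegrE ?l1misalign_ge0 ?mulr_ge0 ?sqrtr_ge0//.
apply: (@le_trans _ _ (\sum_(i < n) d)); last first.
  by rewrite sumr_const card_ord mulr_natl.
apply: ler_sum => i _; have := misalign_coord x y i; case: ifP => _ h.
  rewrite -(ler_pXn2r (n := 2)) ?nnegrE ?sqrtr_ge0// real_normK ?num_real//.
  rewrite d2; lra.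
rewrite -(ler_pXn2r (n := 2)) ?nnegrE ?sqrtr_ge0 ?addr_ge0// d2.
have := sqr_ge0 (`|x 0 i| - `|y 0 i|).
move: h; rewrite -(real_normK (num_real (x 0 i))) -(real_normK (num_real (y 0 i))).
by move: (`|x 0 i|) (`|y 0 i|) => a b; nra.
Qed.

Lemma expr_le_sqr (t : R) m : 0 <= t <= 1 -> (1 < m)%N -> t ^+ m <= t ^+ 2.
Proof.
move=> /andP[t0 t1] m1; rewrite -(subnKC m1) exprD.
by rewrite ler_piMr ?exprn_ge0 ?exprn_ile1.
Qed.

(** The weights t^m and (1-t)^m have sum at most 1, so the square is convex with the remaining
    weight at 0. Then t^m <= t^2 = t - t(1-t), and likewise for 1-t. *)
Lemma high_layer_convex (t a b : R) m : 0 <= t <= 1 -> (1 < m)%N ->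
  (t ^+ m * a + (1 - t) ^+ m * b) ^+ 2 <=
    t * a ^+ 2 + (1 - t) * b ^+ 2 - t * (1 - t) * (a ^+ 2 + b ^+ 2).
Proof.
move=> t01 m1; have t01' : 0 <= 1 - t <= 1 by lra.
have := expr_le_sqr t01 m1; have := expr_le_sqr t01' m1.
have : 0 <= t ^+ m by apply: exprn_ge0; lra.
have : 0 <= (1 - t) ^+ m by apply: exprn_ge0; lra.
move: (t ^+ m) ((1 - t) ^+ m) => u v v0 u0 vt ut.
have uv1 : u + v <= 1 by nra.
apply: (@le_trans _ _ (u * a ^+ 2 + v * b ^+ 2)).
  have : 0 <= u * v * (a - b) ^+ 2 by rewrite mulr_ge0 ?sqr_ge0// mulr_ge0.
  have : 0 <= (1 - (u + v)) * (u * a ^+ 2 + v * b ^+ 2).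
    apply: mulr_ge0; first lra.
    by apply: addr_ge0; apply: mulr_ge0 => //; exact: sqr_ge0.
  lra.
have := ler_wpM2r (sqr_ge0 a) ut; have := ler_wpM2r (sqr_ge0 b) vt.
lra.
Qed.

(* With [X = t x'] and [Y = (1 - t) y'], [X, Y] = t (1 - t) [x' - y', y']. *)
Lemma dilation_bracket_bounded : exists2 K : R, 0 <= K &
  forall x y (t : R), 0 <= t <= 1 -> l1norm (br (dil t x) (dil (1 - t) y)) <=
    K * (t * (1 - t)) * l1misalign x y * l1norm y.
Proof.
have [K K0 HK] := bracket_bounded G; exists K => // x y t t01.
have t01' : 0 <= 1 - t <= 1 by lra.
(* One factor [u] is extracted from the dilation, every layer being at least 1. In the first layer
   [red u] is the identity, which is why only the difference of [x] and [y] is seen there. *)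
pose red (u : R) (z : V) : V := \row_i (u ^+ (lay i).-1 * z 0 i).
have dilE u z : dil u z = u *: red u z.
  by apply/rowP => i; rewrite !mxE mulrA -exprS prednK ?layer_gt0.
have red_le u z i : 0 <= u <= 1 -> `|red u z 0 i| <= `|z 0 i|.
  move=> /andP[u0 u1]; rewrite mxE normrM ger0_norm ?exprn_ge0//.
  by rewrite ler_piMl ?exprn_ile1.
rewrite !dilE bracketZl bracketZr scalerA l1normZ ger0_norm ?mulr_ge0//; try lra.
rewrite bracketBl_self.
have t0 : 0 <= t * (1 - t) by nra.
rewrite [leRHS](_ : _ = t * (1 - t) * (K * l1misalign x y * l1norm y)); last ring.
rewrite [leLHS](_ : _ = t * (1 - t) *
  l1norm (br (red t x - red (1 - t) y) (red (1 - t) y))); last ring.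
apply: ler_wpM2l => //; apply: le_trans (HK _ _) _.
apply: ler_pM; rewrite ?mulr_ge0 ?l1norm_ge0//; last first.
  by apply: ler_sum => i _; exact: red_le.
apply: ler_wpM2l => //; apply: ler_sum => i _.
rewrite [in X in `|X|]mxE [(- _ : 'rV__) _ _]mxE.
case: eqP => [i1|_]; first by rewrite !mxE i1 /= !expr0 !mul1r.
apply: le_trans (ler_normB _ _) _; apply: lerD; exact: red_le.
Qed.

Lemma cmul_dilation_convex : exists2 eta0 : R, 0 < eta0 &
  forall eta : R, 0 < eta < eta0 -> forall x y (t : R), 0 <= t <= 1 ->
    sqsum x <= eta ^+ 2 -> sqsum y <= eta ^+ 2 ->
    sqsum (cmul (dil t x) (dil (1 - t) y)) <=
      t * sqsum x + (1 - t) * sqsum y - t * (1 - t) / 2 * misalign x y.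
Proof.
have [C C0 HC] := cmul_bounded G (ler0n R n).
have [K K0 HK] := dilation_bracket_bounded.
(* The commutator part of the product has norm at most A eta t(1-t) D, with D = [l1misalign x y].
   [B] is the cost after squaring, summing over [n] coordinates and passing from D^2 to [misalign].
   The threshold gives eta <= 1, so that radius [n] suffices in [cmul_bounded], and B eta <= 1/2. *)
pose A := C * K * n%:R; have A0 : 0 <= A by rewrite /A; nonneg.
pose B := n%:R * (2 * A + A ^+ 2) * (2 * n%:R ^+ 2).
have B0 : 0 <= B by rewrite /B; nonneg.
exists (1 + 2 * B)^-1; first by rewrite invr_gt0; lra.
move=> eta /andP[eta0 etaB] x y t t01 xe ye.
have eta1 : eta <= 1 by apply: le_trans (ltW etaB) _; rewrite invf_le1; lra.
have etaB2 : B * eta <= 2^-1.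
  have : eta * (1 + 2 * B) < 1 by rewrite -ltr_pdivlMr ?div1r//; lra.
  lra.
have t01' : 0 <= 1 - t <= 1 by lra.
pose tau := t * (1 - t); have tau0 : 0 <= tau by rewrite /tau; nra.
have tau1 : tau <= 1 by rewrite /tau; nra.
pose D := l1misalign x y; have D0 : 0 <= D by exact: l1misalign_ge0.
pose P := cmul (dil t x) (dil (1 - t) y) - dil t x - dil (1 - t) y.
have dil_le (u : R) (z : V) : 0 <= u <= 1 -> l1norm (dil u z) <= l1norm z.
  move=> /andP[u0 u1]; apply: ler_sum => i _; rewrite mxE normrM.
  by rewrite ger0_norm ?exprn_ge0// ler_piMl ?exprn_ile1.
have norm_le (z : V) : sqsum z <= eta ^+ 2 -> l1norm z <= n%:R * eta.
  by apply: sqsum_l1norm; exact: ltW.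
have norm_le1 (z : V) : sqsum z <= eta ^+ 2 -> l1norm z <= n%:R.
  by move=> /norm_le h; apply: le_trans h _; rewrite ler_piMr.
have PA : l1norm P <= A * eta * tau * D.
  apply: le_trans (HC _ _ _ _) _.
  - exact: le_trans (dil_le _ _ t01) (norm_le1 _ xe).
  - exact: le_trans (dil_le _ _ t01') (norm_le1 _ ye).
  rewrite [leRHS](_ : _ = C * (K * tau * D * (n%:R * eta))); last by rewrite /A; ring.
  apply: ler_wpM2l => //; apply: le_trans (HK _ _ _ t01) _.
  by apply: ler_wpM2l; [apply/mulr_ge0 => //; exact/mulr_ge0 | exact: norm_le].
(* In (L + p)^2 the cross term and p^2 are bounded using |L| <= D, |p| <= A eta tau D, and eta, tau
   <= 1. *)
pose W := (2 * A + A ^+ 2) * eta * tau * D ^+ 2.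
have coord i : cmul (dil t x) (dil (1 - t) y) 0 i ^+ 2 <=
    t * x 0 i ^+ 2 + (1 - t) * y 0 i ^+ 2
    - tau * (if lay i == 1%N then (x 0 i - y 0 i) ^+ 2
             else x 0 i ^+ 2 + y 0 i ^+ 2) + W.
  have W0 : 0 <= W by rewrite /W; nonneg.
  case: (eqVneq (lay i) 1%N) => [i1|i1].
    (* In the first layer the product is addition, and the convexity identity for squares is
       exact. *)
    by rewrite (cmul_first_layer _ _ i1) !mxE i1 !expr1 /tau; nra.
  have i2 : (1 < lay i)%N by have := layer_gt0 i; case: (lay i) i1 => [|[]].
  have -> : cmul (dil t x) (dil (1 - t) y) 0 i =
      (t ^+ lay i * x 0 i + (1 - t) ^+ lay i * y 0 i) + P 0 i.
    by rewrite /P !mxE; ring.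
  have h := high_layer_convex (x 0 i) (y 0 i) t01 i2.
  have Pi := le_trans (l1norm_coord P i) PA.
  have Li : `|t ^+ lay i * x 0 i + (1 - t) ^+ lay i * y 0 i| <= D.
    have := l1misalign_coord x y i; rewrite (negPf i1); apply: le_trans.
    apply: le_trans (ler_normD _ _) _; apply: lerD; rewrite normrM ger0_norm.
    - by rewrite ler_piMl ?exprn_ile1//; lra.
    - by apply: exprn_ge0; lra.
    - by rewrite ler_piMl ?exprn_ile1//; lra.
    - by apply: exprn_ge0; lra.
  move: h Pi Li; rewrite -/tau.
  move: (t ^+ _ * _ + _) (P 0 i) => L p h Pi Li.
  have W' : (L + p) ^+ 2 <= L ^+ 2 + W; last lra.
  rewrite sqrrD -addrA lerD2l.
  have Lp : L * p <= D * (A * eta * tau * D).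
    by apply: le_trans (ler_norm _) _; rewrite normrM; apply: ler_pM.
  have pp : p ^+ 2 <= (A * eta * tau * D) * (A * eta * tau * D).
    by rewrite -real_normK ?num_real// expr2; apply: ler_pM.
  have pp' : A * eta * tau * D * (A * eta * tau * D) <= A ^+ 2 * eta * tau * D ^+ 2.
    rewrite [leLHS](_ : _ = (A ^+ 2 * eta * tau * D ^+ 2) * (eta * tau)); last ring.
    by apply: ler_piMr; [nonneg | apply: mulr_ile1 => //; exact: ltW].
  rewrite /W; lra.
(* The commutator errors consume half of the convexity gain; the other half is the term kept in the
   conclusion. *)
have nW : n%:R * W <= tau / 2 * misalign x y.
  have D2 := l1misalign_sqr x y; rewrite -/D in D2.
  apply: (@le_trans _ _ (B * eta * tau * misalign x y)).
    rewrite [leLHS](_ : _ = n%:R * (2 * A + A ^+ 2) * eta * tau * D ^+ 2); last first.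
      by rewrite /W; ring.
    rewrite [leRHS](_ : _ = n%:R * (2 * A + A ^+ 2) * eta * tau *
      (2 * n%:R ^+ 2 * misalign x y)); last by rewrite /B; ring.
    by apply: ler_wpM2l => //; nonneg.
  apply: ler_wpM2r; first exact: misalign_ge0.
  by rewrite (mulrC tau); apply: ler_wpM2r.
apply: le_trans (ler_sum _ (fun i _ => coord i)) _.
rewrite big_split sumr_const card_ord -[W *+ _]mulr_natl sumrB big_split /= -!mulr_sumr.
rewrite -/(sqsum x) -/(sqsum y) -/(misalign x y) -/tau.
lra.
Qed.

End Convexity.

(** * Scalar inequalities and the homogeneous norm of a Euclidean ball *)

Lemma ratio_itv (R : realType) (a b : R) : 0 <= a -> a <= b -> 0 < b ->
  0 <= a / b <= 1.
Proof.
by move=> a0 ab b0; rewrite ler_pdivrMr// mul1r ab andbT divr_ge0// ltW.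
Qed.

Lemma bernoulli_sub (R : realType) (u : R) m : 0 <= u <= 1 ->
  1 - m%:R * u <= (1 - u) ^+ m.
Proof.
move=> u01; elim: m => [|m IH]; first by rewrite mul0r subr0 expr0.
rewrite exprS -natr1.
have : (1 - u) * (1 - m%:R * u) <= (1 - u) * (1 - u) ^+ m.
  by apply: ler_wpM2l => //; lra.
apply: le_trans.
have : 0 <= m%:R * u ^+ 2 by nonneg.
lra.
Qed.

Section HomogeneousNorm.
Variables (R : realType) (n s : nat) (lay : 'I_n -> nat).
Hypothesis lay_gt0 : forall i, (0 < lay i)%N.
Hypothesis lay_le : forall i, (lay i <= s)%N.
Local Notation dil := (dilation lay).
Implicit Types (x y : 'rV[R]_n) (l u : R).

Lemma dilation_comp l u x : dil l (dil u x) = dil (l * u) x.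
Proof. by apply/rowP => i; rewrite !mxE exprMn mulrA. Qed.

Lemma dilation1 x : dil 1 x = x.
Proof. by apply/rowP => i; rewrite !mxE expr1n mul1r. Qed.

Lemma dilationK l x : l != 0 -> dil l (dil l^-1 x) = x.
Proof. by move=> l0; rewrite dilation_comp mulfV// dilation1. Qed.

Lemma dilationVK l x : l != 0 -> dil l^-1 (dil l x) = x.
Proof. by move=> l0; rewrite dilation_comp mulVf// dilation1. Qed.

Lemma sqsum_dilation_le u c x :
  (forall i, x 0 i != 0 -> (u ^+ lay i) ^+ 2 <= c) ->
  sqsum (dil u x) <= c * sqsum x.
Proof.
move=> uc; rewrite mulr_sumr; apply: ler_sum => i _; rewrite mxE exprMn.
have [->|xi] := eqVneq (x 0 i) 0; first by rewrite expr0n !mulr0.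
by apply: ler_wpM2r; [exact: sqr_ge0 | exact: uc].
Qed.

Lemma sqsum_dilation_contract u x : 0 <= u <= 1 ->
  sqsum (dil u x) <= u ^+ 2 * sqsum x.
Proof.
move=> /andP[u0 u1]; apply: sqsum_dilation_le => i _.
rewrite ler_pXn2r ?nnegrE ?exprn_ge0// -(prednK (lay_gt0 i)) exprS.
by rewrite ler_piMr ?exprn_ile1.
Qed.

(** Layer [s] contracts most. Together with [bernoulli_sub], this bound converts a decrease of
    [sqsum] into a decrease of the homogeneous norm. *)
Lemma sqsum_dilation_ge u x : 0 <= u <= 1 ->
  u ^+ (2 * s) * sqsum x <= sqsum (dil u x).
Proof.
move=> /andP[u0 u1]; rewrite mulr_sumr; apply: ler_sum => i _.
rewrite mxE exprMn mulnC exprM; apply: ler_wpM2r; first exact: sqr_ge0.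
rewrite ler_pXn2r ?nnegrE ?exprn_ge0// -(subnK (lay_le i)) exprD.
by rewrite ler_piMl ?exprn_ge0 ?exprn_ile1.
Qed.

Variable eta : R.
Hypothesis eta_gt0 : 0 < eta.
Local Notation N := (hs_norm lay eta).

Lemma enorm_lt x : (enorm x < eta) = (sqsum x < eta ^+ 2).
Proof.
by rewrite -[RHS]ltr_sqrt ?exprn_gt0// sqrtr_sqr ger0_norm// ltW.
Qed.

Lemma hs_norm_set_neq0 x :
  [set l : R | 0 < l /\ enorm (dil l^-1 x) < eta] !=set0.
Proof.
have x0 := sqsum_ge0 x; have e2 : 0 < eta ^+ 2 by exact: exprn_gt0.
(* Since eta^2 l = eta^2 + [sqsum x], the contraction by 1/l already brings the point inside the
   open ball. Nonemptiness ensures that [inf] is a genuine infimum. *)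
pose l := 1 + sqsum x / eta ^+ 2.
have l1 : 1 <= l by rewrite lerDl divr_ge0 // ltW.
have l0 : 0 < l by exact: lt_le_trans l1.
have li : 0 <= l^-1 <= 1 by rewrite invr_ge0 ltW//= invf_le1.
exists l; split => //; rewrite enorm_lt.
apply: le_lt_trans (sqsum_dilation_contract _ li) _.
apply: (@le_lt_trans _ _ (l^-1 * sqsum x)).
  by apply: ler_wpM2r => //; rewrite expr2 ler_piMr//; case/andP: li.
rewrite mulrC ltr_pdivrMr// /l mulrDr mulr1 mulrCA mulfV ?gt_eqF// mulr1; lra.
Qed.

Lemma hs_norm_ge0 x : 0 <= N x.
Proof. by apply: lb_le_inf (hs_norm_set_neq0 x) _ => l [/ltW]. Qed.

Lemma hs_norm_lt_sqsum l x : N x < l -> sqsum (dil l^-1 x) < eta ^+ 2.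
Proof.
move=> /(inf_lt (hs_norm_set_neq0 x))[u [u0]]; rewrite enorm_lt => xu ul.
have l0 := lt_trans u0 ul.
apply: le_lt_trans xu.
have -> : dil l^-1 x = dil (u / l) (dil u^-1 x).
  by rewrite dilation_comp mulrAC mulfV ?gt_eqF// mul1r.
have ul01 : 0 <= u / l <= 1 by apply: ratio_itv => //; exact: ltW.
apply: le_trans (sqsum_dilation_contract _ ul01) _.
by rewrite ler_piMl ?sqsum_ge0// exprn_ile1//; case/andP: ul01.
Qed.

(** The norm is defined by an open ball; replacing [l] by [l + e] contracts strictly, so the closed
    ball gives the same bound. *)
Lemma hs_norm_le l x : 0 < l -> sqsum (dil l^-1 x) <= eta ^+ 2 -> N x <= l.
Proof.
move=> l0 xl; apply/ler_addgt0Pr => e e0; have le0 : 0 < l + e by lra.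
apply: ge_inf; first by exists 0 => u [/ltW].
split => //; rewrite enorm_lt.
have -> : dil (l + e)^-1 x = dil (l / (l + e)) (dil l^-1 x).
  by rewrite dilation_comp mulrAC mulfV ?gt_eqF// mul1r.
have u01 : 0 <= l / (l + e) <= 1.
  by apply: ratio_itv => //; lra.
apply: le_lt_trans (sqsum_dilation_contract _ u01) _.
apply: le_lt_trans (ler_wpM2l _ xl) _; first exact: sqr_ge0.
rewrite gtr_pMl ?exprn_gt0// expr_lt1//; last by case/andP: u01.
by rewrite ltr_pdivrMr// mul1r; lra.
Qed.

Lemma hs_norm_le_of_balls x y : (forall l, 0 < l -> sqsum (dil l^-1 y) <= eta ^+ 2 ->
  sqsum (dil l^-1 x) <= eta ^+ 2) -> N x <= N y.
Proof.
move=> xy; apply/ler_addgt0Pr => e e0.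
have l0 : 0 < N y + e by have := hs_norm_ge0 y; lra.
apply: hs_norm_le => //; apply: xy => //; apply/ltW/hs_norm_lt_sqsum; lra.
Qed.

Lemma hs_norm_mono x y : (forall i, `|x 0 i| <= `|y 0 i|) -> N x <= N y.
Proof.
move=> xy; apply: hs_norm_le_of_balls => l l0; apply: le_trans.
apply: ler_sum => i _; rewrite !mxE !exprMn; apply: ler_wpM2l; first exact: sqr_ge0.
rewrite -(real_normK (num_real (x 0 i))) -(real_normK (num_real (y 0 i))).
by rewrite ler_pXn2r ?nnegrE.
Qed.

Lemma hs_norm_dilation l x : 0 < l -> N (dil l x) = l * N x.
Proof.
have le u y : 0 < u -> N (dil u y) <= u * N y.
  move=> u0; apply/ler_addgt0Pr => e e0.
  have m0 : 0 < N y + e / u by have := hs_norm_ge0 y; have := divr_gt0 e0 u0; lra.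
  have -> : u * N y + e = u * (N y + e / u).
    by rewrite mulrDr mulrCA mulfV ?mulr1// gt_eqF.
  apply: hs_norm_le; first exact: mulr_gt0.
  rewrite dilation_comp invfM mulrAC mulVf ?gt_eqF// mul1r.
  by apply/ltW/hs_norm_lt_sqsum; rewrite ltrDl divr_gt0.
move=> l0; apply/le_anti; rewrite le//=.
have li : 0 < l^-1 by rewrite invr_gt0.
have := le _ (dil l x) li; rewrite dilationVK ?gt_eqF//.
by rewrite mulrC ler_pdivlMr// mulrC.
Qed.

Lemma hs_norm_attained x : 0 < N x -> sqsum (dil (N x)^-1 x) <= eta ^+ 2.
Proof.
set a := N x => a0; rewrite leNgt; apply/negP.
set y := dil _ _; set F := sqsum y => eF.
have e2 : 0 < eta ^+ 2 by exact: exprn_gt0.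
have F0 : 0 < F by exact: lt_trans eF.
pose m : R := (2 * s)%:R; have m0 : 0 <= m by exact: ler0n.
(* If F > eta^2, the point is still outside the open ball at the larger scale a/(1-u), a
   contradiction: the contraction by 1-u leaves at least (1 - m u) F = eta^2 + u F. The [m + 1]
   keeps [u] below 1. *)
pose u := (F - eta ^+ 2) / (F * (m + 1)).
have Fm : 0 < F * (m + 1) by apply: mulr_gt0 => //; lra.
have u0 : 0 < u by rewrite divr_gt0// subr_gt0.
have uE : u * (F * (m + 1)) = F - eta ^+ 2 by rewrite divfK// gt_eqF.
have u1 : u < 1 by rewrite ltr_pdivrMr// mul1r; nra.
have au : a < a / (1 - u) by rewrite ltr_pdivlMr; nra.
have := hs_norm_lt_sqsum au.
have -> : dil (a / (1 - u))^-1 x = dil (1 - u) y.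
  by rewrite dilation_comp invf_div mulrC.
have u01 : 0 <= 1 - u <= 1 by lra.
apply/negP; rewrite -leNgt; apply: le_trans (sqsum_dilation_ge _ u01).
have /(bernoulli_sub (2 * s)) : 0 <= u <= 1 by lra.
rewrite -/m -/F => /(ler_wpM2r (ltW F0)); apply: le_trans.
have : 0 <= u * F by nonneg.
lra.
Qed.

Lemma hs_norm_eq0 x : N x = 0 -> x = 0.
Proof.
move=> Nx; have e2 : 0 < eta ^+ 2 by exact: exprn_gt0.
suff x0 : sqsum x <= 0.
  apply/rowP => i; rewrite mxE; apply/eqP; rewrite -sqrf_eq0 eq_le sqr_ge0 andbT.
  exact: le_trans (sqsum_coord x i) x0.
rewrite leNgt; apply/negP => x0.
(* For S = [sqsum x] this gives l eta^2 = (1-l) S, hence l^2 eta^2 < S, whereas norm 0 < l forces S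
   <= l^2 eta^2. *)
pose l := sqsum x / (sqsum x + eta ^+ 2).
have l0 : 0 < l by rewrite divr_gt0// addr_gt0.
have l1 : l <= 1 by rewrite ler_pdivrMr ?addr_gt0// mul1r; lra.
have := hs_norm_lt_sqsum (l := l) (x := x); rewrite Nx => /(_ l0) xl.
have : sqsum x <= l ^+ 2 * eta ^+ 2.
  rewrite -{1}(@dilationK l x) ?gt_eqF//.
  apply: le_trans (sqsum_dilation_contract _ _) _; first by rewrite l1 ltW.
  by apply: ler_wpM2l; [exact: sqr_ge0 | exact: ltW].
have lE : l * (sqsum x + eta ^+ 2) = sqsum x by rewrite divfK// gt_eqF// addr_gt0.
nra.
Qed.

Lemma hs_norm_le1_sqsum x : 0 < N x <= 1 -> sqsum x <= eta ^+ 2.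
Proof.
move=> /andP[x0 x1]; apply: le_trans (hs_norm_attained x0).
rewrite -{1}(@dilationK (N x) x) ?gt_eqF//.
apply: le_trans (sqsum_dilation_contract _ _) _; first by rewrite x1 ltW.
by rewrite ler_piMl ?sqsum_ge0// exprn_ile1// ltW.
Qed.

(** At small scales the inverse dilation magnifies by at most the power [k] of the scale, since
    layers above [k] vanish. At large scales the square is enough, and [M] caps the remaining
    power. *)
Lemma hs_norm_power k (M : R) : (0 < k)%N -> 0 <= M ->
  exists2 C, 0 <= C & forall x, (forall i, (k < lay i)%N -> x 0 i = 0) ->
    sqsum x <= M -> N x ^+ (2 * k) <= C * sqsum x.
Proof.
move=> k0 M0; have e2 : 0 < eta ^+ 2 by exact: exprn_gt0.
(* The term 1 serves scales l <= 1; the other one bounds (l^2)^(k-1) when l > 1. *)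
pose B := 1 + (M / eta ^+ 2) ^+ k.-1.
have B1 : 1 <= B by rewrite lerDl exprn_ge0// divr_ge0// ltW.
exists (2 ^+ (2 * k) * (B / eta ^+ 2)).
  by rewrite mulr_ge0 ?exprn_ge0// divr_ge0 ?ltW//; lra.
move=> x xk xM; have [-> | Nx0] := eqVneq (N x) 0.
  rewrite expr0n muln_eq0 /= eqn0Ngt k0 /=.
  by rewrite !mulr_ge0 ?exprn_ge0 ?sqsum_ge0 ?invr_ge0 ?(ltW e2)//; lra.
have N0 : 0 < N x by rewrite lt_neqAle eq_sym Nx0 hs_norm_ge0.
(* Half the norm is strictly below the infimum, so the point rescaled by [l] lies outside the
   ball. *)
pose l := N x / 2; have l0 : 0 < l by rewrite /l; lra.
have -> : N x = 2 * l by rewrite /l; lra.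
rewrite exprMn -mulrA; apply: ler_wpM2l; first exact: exprn_ge0.
have xl : eta ^+ 2 <= sqsum (dil l^-1 x).
  rewrite leNgt; apply/negP => /ltW /(hs_norm_le l0); rewrite /l; lra.
rewrite mulrAC ler_pdivlMr//.
have li0 : 0 < l^-1 by rewrite invr_gt0.
have lK m (q : R) : l ^+ m * (l^-1 ^+ m * q) = q.
  by rewrite [LHS]mulrA -exprMn mulfV ?gt_eqF// expr1n mul1r.
case: (leP l 1) => l1.
  have li1 : 1 <= l^-1 by rewrite invf_ge1.
  have h : eta ^+ 2 <= (l^-1) ^+ (2 * k) * sqsum x.
    apply: le_trans xl _; apply: sqsum_dilation_le => i xi.
    have ik : (lay i <= k)%N by rewrite leqNgt; apply: contra xi => /xk ->.
    by rewrite mulnC exprM ler_pXn2r ?nnegrE ?exprn_ge0 ?(ltW li0)// ler_weXn2l.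
  have := ler_wpM2l (exprn_ge0 (2 * k) (ltW l0)) h.
  rewrite lK => /le_trans; apply.
  by rewrite ler_peMl// sqsum_ge0.
have li1 : l^-1 <= 1 by rewrite invf_le1// ltW.
have h : eta ^+ 2 <= (l^-1) ^+ 2 * sqsum x.
  apply: le_trans xl _; apply: sqsum_dilation_contract; rewrite li1 ltW//.
have {h} := ler_wpM2l (exprn_ge0 2 (ltW l0)) h.
rewrite lK => h.
have lM : l ^+ 2 <= M / eta ^+ 2 by rewrite ler_pdivlMr//; exact: le_trans h xM.
rewrite exprM -(prednK k0) exprSr -mulrA.
apply: ler_pM => //; [by nonneg | by nonneg |].
apply: (@le_trans _ _ ((M / eta ^+ 2) ^+ k.-1)); last by rewrite /B lerDr.
by rewrite lerXn2r ?nnegrE ?sqr_ge0// divr_ge0// ltW.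
Qed.

End HomogeneousNorm.

(** * Quantitative triangle inequality and deviation of horizontal segments *)

Section TriangleExcess.
Variables (R : realType) (s : nat) (G : carnot_group R s) (eta : R).
Hypothesis s_gt0 : (0 < s)%N.
Hypothesis eta_gt0 : 0 < eta.
Local Notation V := 'rV[R]_(cdim G).
Local Notation br := (@bracket R s G).
Local Notation lay := (@layer R s G).
Local Notation dil := (dilation lay).
Local Notation n := (cdim G).
Local Notation N := (hs_norm lay eta).
Hypothesis ball_convex : forall (x y : V) (t : R), 0 <= t <= 1 ->
  sqsum x <= eta ^+ 2 -> sqsum y <= eta ^+ 2 ->
  sqsum (cmul (dil t x) (dil (1 - t) y)) <=
    t * sqsum x + (1 - t) * sqsum y - t * (1 - t) / 2 * misalign x y.
Implicit Types (g h f x y z : V).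

Let lay_gt0 : forall i, (0 < lay i)%N := @layer_gt0 R s G.
Let lay_le : forall i, (lay i <= s)%N := @layer_le R s G.

Lemma hs_norm_cmul_gap g h : 0 < N g -> 0 < N h ->
  N (cmul g h) + N g * N h / (N g + N h) *
    misalign (dil (N g)^-1 g) (dil (N h)^-1 h) / (4 * s%:R * eta ^+ 2)
  <= N g + N h.
Proof.
move=> a0 b0; have e2 : 0 < eta ^+ 2 by exact: exprn_gt0.
have s1 : (1 : R) <= s%:R by rewrite ler1n.
have xe := hs_norm_attained lay_gt0 lay_le eta_gt0 a0.
have ye := hs_norm_attained lay_gt0 lay_le eta_gt0 b0.
move: a0 b0 xe ye; set a := N g; set b := N h => a0 b0.
set x := dil a^-1 g; set y := dil b^-1 h => xe ye.
have ab0 : 0 < a + b by exact: addr_gt0.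
pose t := a / (a + b).
have t01 : 0 <= t <= 1 by apply: ratio_itv => //; lra.
have tb : 1 - t = b / (a + b) by rewrite /t; field; exact: lt0r_neq0.
have := ball_convex t01 xe ye.
have -> : cmul (dil t x) (dil (1 - t) y) = dil (a + b)^-1 (cmul g h).
  rewrite dilation_cmul !dilation_comp tb /t.
  by rewrite !(mulrAC _ (a + b)^-1) !mulfV ?gt_eqF// mul1r.
set Z := dil _ (cmul g h); set D := misalign x y => Zle.
have D0 : 0 <= D by exact: misalign_ge0.
have tt0 : 0 <= t * (1 - t) by apply: mulr_ge0; lra.
pose q := t * (1 - t) / 2 * D.
have q0 : 0 <= q by rewrite /q mulr_ge0// divr_ge0.
have Zq : sqsum Z <= eta ^+ 2 - q.
  apply: le_trans Zle _; rewrite -/q lerD2r.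
  have t1 : 0 <= 1 - t by lra.
  have t0 : 0 <= t by lra.
  have := ler_wpM2l t0 xe; have := ler_wpM2l t1 ye; lra.
have qe : q <= eta ^+ 2 by have := sqsum_ge0 Z; lra.
pose m : R := (2 * s)%:R; have m2 : 2 <= m by rewrite /m natrM; lra.
have m0 : 0 < m by lra.
(* By Bernoulli, (1-u)^(2s) eta^2 >= eta^2 - q, which dominates [sqsum Z]; hence [N Z] is at most
   1-u, and (a+b) u is the claimed gap. *)
pose u := q / (m * eta ^+ 2).
have me0 : 0 < m * eta ^+ 2 by exact: mulr_gt0.
have uE : u * (m * eta ^+ 2) = q by rewrite divfK// gt_eqF.
have u01 : 0 <= u <= 2^-1.
  by rewrite /u divr_ge0 ?(ltW me0)//= ler_pdivrMr//; nra.
pose mu := 1 - u; have mu0 : 0 < mu by rewrite /mu; lra.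
have mu01 : 0 <= mu <= 1 by rewrite /mu; lra.
have NZ : N Z <= mu.
  apply: hs_norm_le => //.
  have mus : 0 < mu ^+ (2 * s) by exact: exprn_gt0.
  rewrite -(ler_pM2l mus); apply: le_trans (sqsum_dilation_ge lay_le _ mu01) _.
  rewrite dilationK ?gt_eqF//; apply: le_trans Zq _.
  have /(bernoulli_sub (2 * s)) : 0 <= u <= 1 by lra.
  rewrite -/m -/mu => /(ler_wpM2r (ltW e2)); apply: le_trans; lra.
have -> : N (cmul g h) = (a + b) * N Z.
  by rewrite -hs_norm_dilation// dilationK// gt_eqF.
have -> : a * b / (a + b) * D / (4 * s%:R * eta ^+ 2) = (a + b) * u.
  rewrite /u /q tb /t /m natrM; field.
  by rewrite !gt_eqF//; lra.
rewrite -mulrDr -[leRHS]mulr1; apply: ler_wpM2l; first exact: ltW.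
by move: NZ; rewrite /mu; lra.
Qed.

Lemma hs_norm_cmul g h : N (cmul g h) <= N g + N h.
Proof.
have [g0|g0] := eqVneq (N g) 0.
  by rewrite (hs_norm_eq0 lay_gt0 eta_gt0 g0) cmul0g lerDr hs_norm_ge0.
have [h0|h0] := eqVneq (N h) 0.
  by rewrite (hs_norm_eq0 lay_gt0 eta_gt0 h0) cmulg0 lerDl hs_norm_ge0.
have a0 : 0 < N g by rewrite lt_neqAle eq_sym g0 hs_norm_ge0.
have b0 : 0 < N h by rewrite lt_neqAle eq_sym h0 hs_norm_ge0.
apply: le_trans (hs_norm_cmul_gap a0 b0); rewrite lerDl.
have ab0 : 0 <= N g * N h / (N g + N h).
  by rewrite divr_ge0 ?addr_ge0 ?mulr_ge0 ?hs_norm_ge0.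
have e0 : 0 <= 4 * s%:R * eta ^+ 2 by nonneg.
exact: divr_ge0 (mulr_ge0 ab0 (misalign_ge0 _ _)) e0.
Qed.

(** The triangle inequality in the quotients is inherited from [G], because truncating coordinates
    cannot increase the norm. *)
Lemma hs_norm_trunc_cmul k g h :
  N (trunc k (cmul g h)) <= N (trunc k g) + N (trunc k h).
Proof.
rewrite trunc_cmul; apply: le_trans (hs_norm_cmul _ _).
apply: hs_norm_mono => // i; rewrite mxE; case: ifP => // _.
by rewrite normr0.
Qed.

Lemma horizontalD x y : horizontal (x + y) = horizontal x + horizontal y.
Proof. by apply/rowP => i; rewrite !mxE; case: ifP; rewrite ?addr0. Qed.

Lemma horizontal_cmul g h : horizontal (cmul g h) = horizontal g + horizontal h.
Proof.
rewrite -horizontalD; apply/rowP => i; rewrite !mxE; case: eqP => // i1.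
by rewrite cmul_first_layer.
Qed.

Lemma horizontal_dilation u x : horizontal (dil u x) = u *: horizontal x.
Proof.
apply/rowP => i; rewrite !mxE; case: eqP => [->|]; last by rewrite mulr0.
by rewrite expr1.
Qed.

Lemma dilation_horizontal u x : dil u (horizontal x) = u *: horizontal x.
Proof.
apply/rowP => i; rewrite !mxE; case: eqP => [->|]; last by rewrite !mulr0.
by rewrite expr1.
Qed.

Lemma l1norm_horizontal x : l1norm (horizontal x) <= l1norm x.
Proof. by apply: ler_sum => i _; rewrite mxE; case: ifP; rewrite ?normr0. Qed.

Lemma misalign_le_excess lambda g h (E : R) : 0 < lambda ->
  lambda <= N g <= 1 -> lambda <= N h <= 1 -> N g + N h - N (cmul g h) <= E ->
  misalign (dil (N g)^-1 g) (dil (N h)^-1 h) <=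
    8 * s%:R * eta ^+ 2 / lambda ^+ 2 * E.
Proof.
move=> l0 gl hl gE.
have a0 : 0 < N g by lra.
have b0 : 0 < N h by lra.
have := hs_norm_cmul_gap a0 b0.
set D := misalign _ _ => gap; have D0 : 0 <= D by exact: misalign_ge0.
have s0 : (0 : R) < s%:R by rewrite ltr0n.
have c0 : 0 < 4 * s%:R * eta ^+ 2 by rewrite !mulr_gt0.
(* This is where comparability of the distances enters: the lower bound [lambda] keeps the gap from
   degenerating. *)
have ab : lambda ^+ 2 / 2 <= N g * N h / (N g + N h).
  rewrite ler_pdivlMr ?addr_gt0//; move: gl hl; clear -l0.
  by move: (N g) (N h) => a b; nra.
have : lambda ^+ 2 / 2 * D / (4 * s%:R * eta ^+ 2) <= E.
  apply: (@le_trans _ _ (N g + N h - N (cmul g h))) => //.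
  rewrite lerBrDl; apply: le_trans gap; rewrite lerD2l.
  by rewrite ler_pM2r ?invr_gt0//; exact: ler_wpM2r.
rewrite ler_pdivrMr// => h1.
rewrite [leRHS](_ : _ = E * (4 * s%:R * eta ^+ 2) / (lambda ^+ 2 / 2)); last first.
  by field; exact: lt0r_neq0.
rewrite ler_pdivlMr; last by rewrite divr_gt0// exprn_gt0.
by rewrite mulrC.
Qed.

(** After translation and rescaling, [g], [h], [f] are the increments p1 to p3, p3 to p4, p4 to p5,
    and [z] joins the point [r] of the line from p1 towards p5 to the point [t] of the line from p3
    towards p4. The bound by [M] is what allows [hs_norm_power] to be applied to [z]. *)
Lemma segment_deviation (lambda : R) : 0 < lambda ->
  exists C M : R, [/\ 0 <= C, 0 <= M & forall g h f (E t : R),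
    lambda <= N g <= 1 -> lambda <= N h <= 1 -> lambda <= N f <= 1 ->
    N g + N h - N (cmul g h) <= E -> N h + N f - N (cmul h f) <= E ->
    0 <= t <= 1 -> exists2 r, 0 <= r <= 1 &
      let z := cmul (- (r *: horizontal (cmul g (cmul h f))))
                    (cmul g (t *: horizontal h)) in
      sqsum z <= M /\ sqsum z <= C * E].
Proof.
move=> l0.
have [K K0 HK] := bracket_bounded G.
(* With [A], [B], [W] as below, [M0] bounds [g] and [B], [M1] bounds [A] (three horizontal pieces),
   [M2] bounds [W] and [M3] bounds [z]. With d^2 = kappa E, [Q * d] bounds [A + W] and [Q2 * d]
   bounds [z]. *)
pose M0 := n%:R * eta; have M00 : 0 <= M0 by rewrite /M0; nonneg.
have [C1 C10 HC1] := cmul_bounded G M00.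
pose M2 := C1 * (K * M0 * M0) + (M0 + M0).
have M20 : 0 <= M2 by rewrite /M2; nonneg.
pose M1 := 3 * M0; have M10 : 0 <= M1 by rewrite /M1; nonneg.
have [C2 C20 HC2] := cmul_bounded G (addr_ge0 M10 M20).
pose M3 := C2 * (K * M1 * M2) + (M1 + M2).
have M30 : 0 <= M3 by rewrite /M3; nonneg.
pose n2 : R := n%:R + n%:R; have n20 : 0 <= n2 by rewrite /n2; nonneg.
pose Q := C1 * (K * n2 * M0) + (n2 + n2).
have Q0 : 0 <= Q by rewrite /Q; nonneg.
pose Q2 := C2 * (K * Q * M2) + Q; have Q20 : 0 <= Q2 by rewrite /Q2; nonneg.
pose kappa := 8 * s%:R * eta ^+ 2 / lambda ^+ 2.
have kappa0 : 0 <= kappa by rewrite /kappa divr_ge0//; nonneg.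
exists (Q2 ^+ 2 * kappa), (M3 ^+ 2); split; [by nonneg | by nonneg |].
move=> g h f E t gl hl fl ghE hfE t01.
have xy := misalign_le_excess l0 gl hl ghE.
have yw := misalign_le_excess l0 hl fl hfE.
have /andP[/(lt_le_trans l0) a0 a1] := gl.
have /andP[/(lt_le_trans l0) b0 b1] := hl.
have /andP[/(lt_le_trans l0) c0 c1] := fl.
have /andP[t0 t1] := t01.
have ge : sqsum g <= eta ^+ 2.
  by apply: (hs_norm_le1_sqsum lay_gt0 lay_le eta_gt0); rewrite a0 a1.
have xe := hs_norm_attained lay_gt0 lay_le eta_gt0 a0.
have ye := hs_norm_attained lay_gt0 lay_le eta_gt0 b0.
have we := hs_norm_attained lay_gt0 lay_le eta_gt0 c0.
pose a := N g; pose b := N h; pose c := N f.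
rewrite -/a in a0 a1 xy xe; rewrite -/b in b0 b1 xy yw ye.
rewrite -/c in c0 c1 yw we.
have a01 : 0 <= a <= 1 by rewrite ltW.
have b01 : 0 <= b <= 1 by rewrite ltW.
have c01 : 0 <= c <= 1 by rewrite ltW.
pose x := dil a^-1 g; pose y := dil b^-1 h; pose w := dil c^-1 f.
rewrite -/x -/y -/w -/kappa in xy yw xe ye we.
have gx : g = dil a x by rewrite /x dilationK// gt_eqF.
have hy : h = dil b y by rewrite /y dilationK// gt_eqF.
have fw : f = dil c w by rewrite /w dilationK// gt_eqF.
clearbody x y w.
have kE0 : 0 <= kappa * E by exact: le_trans (misalign_ge0 _ _) xy.
pose d := Num.sqrt (kappa * E); have d0 : 0 <= d by exact: sqrtr_ge0.
have d2 : d ^+ 2 = kappa * E by exact: sqr_sqrtr.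
rewrite -d2 in xy yw.
(* The common direction: the horizontal parts of [x] and [w] differ from it by at most n d. *)
pose u := horizontal y.
have l1M0 z : sqsum z <= eta ^+ 2 -> l1norm z <= M0.
  by move=> ze; apply: sqsum_l1norm => //; exact: ltW.
have hM0 z : sqsum z <= eta ^+ 2 -> l1norm (horizontal z) <= M0.
  by move=> ze; apply: le_trans (l1norm_horizontal z) (l1M0 _ ze).
have hxu : l1norm (u - horizontal x) <= n%:R * d.
  by rewrite -opprB l1normN; exact: horizontal_diff.
have hwu : l1norm (u - horizontal w) <= n%:R * d by exact: horizontal_diff.
have gu : l1norm (g - a *: u) <= n2 * d.
  rewrite [g - _](_ : _ = (g - horizontal g) + - (a *: (u - horizontal x))); last first.
    by rewrite [in horizontal g]gx horizontal_dilation scalerBr opprB addrA subrK.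
  apply: le_trans (l1normD _ _) _; rewrite l1normN l1normZ mulrDl; apply: lerD.
    apply: le_trans (vertical_bound d0 xy); apply: ler_sum => i _.
    rewrite !mxE; case: ifP => _; first by rewrite !subrr.
    rewrite !subr0 gx mxE normrM ger0_norm; last by apply/exprn_ge0/ltW.
    by rewrite ler_piMl// exprn_ile1// ltW.
  apply: le_trans hxu; rewrite ger0_norm ?(ltW a0)//.
  by rewrite ler_piMl ?l1norm_ge0.
have hh : horizontal h = b *: u by rewrite hy horizontal_dilation.
have abc : 0 < a + b + c by rewrite !addr_gt0.
(* The fraction of the total length travelled; it makes the multiples of [u] cancel in [A + W]. *)
pose r := (a + t * b) / (a + b + c).
have tb : 0 <= t * b by rewrite mulr_ge0// ltW.
have tb1 : t * b <= b by rewrite ler_piMl// ltW.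
have r01 : 0 <= r <= 1.
  apply: ratio_itv => //; first by rewrite addr_ge0// ltW.
  by rewrite -addrA lerD2l; apply: le_trans tb1 _; rewrite lerDl ltW.
have rE : t * b = r * (a + b + c) - a by rewrite /r divfK ?gt_eqF//; ring.
have r1 : `|r| <= 1 by case/andP: r01 => r0 r1; rewrite ger0_norm.
exists r => // z.
pose A := - (r *: horizontal (cmul g (cmul h f))).
pose B := t *: horizontal h.
pose W := cmul g B.
have vE : horizontal (cmul g (cmul h f)) =
    a *: horizontal x + (b *: u + c *: horizontal w).
  by rewrite !horizontal_cmul {1}gx {1}hy {1}fw !horizontal_dilation.
have le1 (p q : R) : 0 <= p <= 1 -> 0 <= q -> p * q <= q.
  by move=> /andP[_ p1] q0; rewrite ler_piMl.
have AM1 : l1norm A <= M1.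
  rewrite l1normN l1normZ; apply: (@le_trans _ _ (1 * M1)); last by rewrite mul1r.
  apply: ler_pM => //; first exact: l1norm_ge0.
  rewrite vE [M1](_ : _ = M0 + (M0 + M0)); last by rewrite /M1; ring.
  have piece (p : R) (q : V) : 0 <= p <= 1 -> sqsum q <= eta ^+ 2 ->
      l1norm (p *: horizontal q) <= M0.
    move=> p01 qe; rewrite l1normZ ger0_norm; last by case/andP: p01.
    exact: le_trans (le1 _ _ p01 (l1norm_ge0 _)) (hM0 _ qe).
  apply: le_trans (l1normD _ _) _; apply: lerD; first exact: piece.
  by apply: le_trans (l1normD _ _) _; apply: lerD; exact: piece.
have BE : B = (t * b) *: u by rewrite /B hh scalerA.
have BM0 : l1norm B <= M0.
  rewrite BE l1normZ ger0_norm//; apply: le_trans (le1 _ _ _ (l1norm_ge0 _)) _.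
    by rewrite tb (le_trans tb1).
  exact: hM0.
have gM0 := l1M0 _ ge.
have P1 : l1norm (W - g - B) <= C1 * (K * n2 * M0) * d.
  apply: le_trans (HC1 _ _ gM0 BM0) _.
  rewrite -mulrA; apply: ler_wpM2l => //.
  (* [B] is a multiple of [u], so only the deviation of [g] from [a *: u] is left, which gains the
     factor [d]. *)
  have -> : br g B = br (g - a *: u) B.
    rewrite BE bracketDl -scaleNr bracketZl !bracketZr bracketxx.
    by rewrite !scaler0 addr0.
  apply: le_trans (HK _ _) _.
  rewrite [leRHS](_ : _ = K * (n2 * d) * M0); last ring.
  by apply: ler_pM; rewrite ?l1norm_ge0 ?mulr_ge0 ?l1norm_ge0// ler_wpM2l.
have WM2 : l1norm W <= M2.
  rewrite [W](_ : _ = (W - g - B) + (g + B)); last by rewrite -(addrA W) -opprD subrK.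
  apply: le_trans (l1normD _ _) _; apply: lerD.
    apply: le_trans (HC1 _ _ gM0 BM0) _; apply: ler_wpM2l => //.
    apply: le_trans (HK _ _) _.
    by apply: ler_pM; rewrite ?l1norm_ge0 ?mulr_ge0 ?l1norm_ge0// ler_wpM2l.
  by apply: le_trans (l1normD _ _) _; exact: lerD.
have AW : l1norm (A + W) <= Q * d.
  rewrite [A + W](_ : _ = (W - g - B) + ((g - a *: u)
    + ((r * a) *: (u - horizontal x) + (r * c) *: (u - horizontal w)))); last first.
    rewrite /A vE BE rE; move: (horizontal x) (horizontal w) => hx hw.
    by apply/rowP => i; rewrite !mxE; ring.
  rewrite mulrDl; apply: le_trans (l1normD _ _) _; apply: lerD => //.
  rewrite mulrDl; apply: le_trans (l1normD _ _) _; apply: lerD => //.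
  rewrite mulrDl; apply: le_trans (l1normD _ _) _.
  have piece (p : R) (q : V) : 0 <= p <= 1 -> l1norm q <= n%:R * d ->
      l1norm ((r * p) *: q) <= n%:R * d.
    move=> p01 qd; rewrite l1normZ; apply: le_trans qd.
    rewrite normrM (ger0_norm (x := p)); last by case/andP: p01.
    by case/andP: p01 => p0 p1; rewrite ler_piMl ?l1norm_ge0// mulr_ile1.
  by apply: lerD; exact: piece.
have zd : l1norm (z - A - W) <= C2 * l1norm (br A W).
  apply: HC2; [apply: le_trans AM1 _ | apply: le_trans WM2 _].
    by rewrite lerDl.
  by rewrite lerDr.
have zE : z = (z - A - W) + (A + W) by rewrite -(addrA z) -opprD subrK.
have zM3 : l1norm z <= M3.
  rewrite zE; apply: le_trans (l1normD _ _) _; apply: lerD.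
    apply: le_trans zd _; apply: ler_wpM2l => //; apply: le_trans (HK _ _) _.
    by apply: ler_pM; rewrite ?l1norm_ge0 ?mulr_ge0 ?l1norm_ge0// ler_wpM2l.
  by apply: le_trans (l1normD _ _) _; exact: lerD.
have zQ2 : l1norm z <= Q2 * d.
  rewrite zE mulrDl; apply: le_trans (l1normD _ _) _; apply: lerD => //.
  apply: le_trans zd _; rewrite -mulrA; apply: ler_wpM2l => //.
  (* [A] and [W] are almost opposite, so their bracket is as small as [A + W]. *)
  rewrite bracketDl_self; apply: le_trans (HK _ _) _.
  rewrite [leRHS](_ : _ = K * (Q * d) * M2); last ring.
  by apply: ler_pM; rewrite ?l1norm_ge0 ?mulr_ge0 ?l1norm_ge0// ler_wpM2l.
split; apply: le_trans (sqsum_le_l1norm z) _.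
  by rewrite ler_pXn2r ?nnegrE ?l1norm_ge0.
rewrite -mulrA -d2 -exprMn ler_pXn2r ?nnegrE ?l1norm_ge0//.
exact: mulr_ge0.
Qed.

End TriangleExcess.

(** * Transfer of distances and excesses from the quotients to truncations in [G] *)

Section Quotients.
Variables (R : realType) (s : nat) (G : carnot_group R s) (eta : R).
Local Notation V := 'rV[R]_(cdim G).
Local Notation lay := (@layer R s G).
Local Notation dil := (dilation lay).
Local Notation N := (hs_norm lay eta).
Implicit Types x y z : V.

Lemma trunc_step x : trunc s x = x.
Proof. by apply/rowP => i; rewrite mxE layer_le. Qed.

Lemma trunc_dilation k u x : trunc k (dil u x) = dil u (trunc k x).
Proof. by apply/rowP => i; rewrite !mxE; case: ifP; rewrite ?mulr0. Qed.

Lemma sqsum_trunc k x : sqsum (trunc k x) <= sqsum x.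
Proof.
by apply: ler_sum => i _; rewrite mxE; case: ifP => // _; rewrite expr0n sqr_ge0.
Qed.

Lemma qlift_qproj k x : qlift (qproj k x) = trunc k x.
Proof.
rewrite [RHS]row_sum_delta (bigID (mem (low G k))) /= [X in _ + X]big1 ?addr0.
  rewrite [RHS]big_enum_val /=; apply: eq_bigr => i _; rewrite !mxE.
  by have := enum_valP i; rewrite inE => ->.
by move=> i; rewrite inE mxE => /negPf ->; rewrite scale0r.
Qed.

Lemma qproj_trunc k x : qproj k (trunc k x) = qproj k x.
Proof. by apply/rowP => i; rewrite !mxE; have := enum_valP i; rewrite inE => ->. Qed.

Lemma qmul_qproj k x y : qmul (qproj k x) (qproj k y) = qproj k (cmul x y).
Proof. by rewrite /qmul !qlift_qproj -qproj_trunc -trunc_cmul qproj_trunc. Qed.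

Lemma enorm_qproj k u x :
  enorm (dilation (@qlayer _ _ G k) u (qproj k x)) = enorm (dil u (trunc k x)).
Proof.
congr Num.sqrt; rewrite [RHS](bigID (mem (low G k))) /= [X in _ + X]big1 ?addr0.
  rewrite [RHS]big_enum_val /=; apply: eq_bigr => i _; rewrite !mxE.
  by have := enum_valP i; rewrite inE => ->.
by move=> i; rewrite inE !mxE => /negPf ->; rewrite mulr0 expr0n.
Qed.

Lemma hs_norm_qproj k x : hs_norm (@qlayer _ _ G k) eta (qproj k x) = N (trunc k x).
Proof.
by rewrite /hs_norm; congr inf; apply/seteqP; split => l /=; rewrite enorm_qproj.
Qed.

(** Every quotient distance that occurs is between projected points, so after this all estimates
    take place in [G]. *)
Lemma qdist_qproj k x y :
  qdist eta (qproj k x) (qproj k y) = N (trunc k (cmul (- x) y)).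
Proof.
rewrite /qdist -hs_norm_qproj; congr hs_norm; rewrite -qmul_qproj; congr qmul.
by apply/rowP => i; rewrite !mxE.
Qed.

Lemma excess_five k (p1 p2 p3 p4 p5 : V) :
  let d x y := N (trunc k (cmul (- x) y)) in
  excess eta k [:: p1; p2; p3; p4; p5] =
    d p1 p2 + d p2 p3 + d p3 p4 + d p4 p5 - d p1 p5.
Proof.
rewrite /excess /= !big_ord_recl big_ord0 /= !qdist_qproj addr0.
by rewrite !addrA.
Qed.

Hypothesis eta_gt0 : 0 < eta.

Lemma hs_normN x : N (- x) = N x.
Proof.
have lg := @layer_gt0 R s G.
by apply/le_anti/andP; split; apply: hs_norm_mono => // i; rewrite mxE normrN.
Qed.

Lemma hs_norm_power_uniform m (M : R) : 0 <= M ->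
  exists2 C, 0 <= C & forall k x, (0 < k <= m)%N -> sqsum x <= M ->
    N (trunc k x) ^+ (2 * k) <= C * sqsum x.
Proof.
move=> M0; elim: m => [|m [C C0 HC]].
  by exists 0 => // k x /andP[k0]; rewrite leqNgt k0.
have [C' C'0 HC'] := hs_norm_power (@layer_gt0 R s G) eta_gt0 (ltn0Sn m) M0.
exists (C + C'); first exact: addr_ge0.
move=> k x /andP[k0 km] xM; have x0 := sqsum_ge0 x; rewrite mulrDl.
case: (ltngtP k m.+1) km => // [km _|-> _].
  apply: le_trans (HC k x _ xM) _; first by rewrite k0 -ltnS.
  by rewrite lerDl mulr_ge0.
have xt := sqsum_trunc m.+1 x.
apply: le_trans (HC' (trunc m.+1 x) _ (le_trans xt xM)) _.
  by move=> i; rewrite mxE ltnNge => /negPf ->.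
apply: le_trans (ler_wpM2l C'0 xt) _; rewrite lerDr mulr_ge0//.
Qed.

End Quotients.

(** * Excess of a five-point path and assembly of the estimate *)

Lemma path_excess (R : realType) (T : Type) (d : T -> T -> R) :
  (forall x y z, d x z <= d x y + d y z) ->
  forall p1 p2 p3 p4 p5,
    let D := d p1 p2 + d p2 p3 + d p3 p4 + d p4 p5 - d p1 p5 in
    [/\ 0 <= D, d p1 p3 + d p3 p4 - d p1 p4 <= D
      & d p3 p4 + d p4 p5 - d p3 p5 <= D].
Proof.
move=> tri p1 p2 p3 p4 p5 D; rewrite {}/D.
(* Both differences with D are sums of triangle excesses: of (p1,p2,p3) and (p1,p4,p5) for the
   first, of (p1,p2,p3) and (p1,p3,p5) for the second. *)
have := tri p1 p2 p3; have := tri p1 p3 p4; have := tri p1 p4 p5.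
by have := tri p1 p3 p5; split; lra.
Qed.

Theorem corollary5p7 (R : realType) (s : nat) (hs : (1 < s)%N)
  (G : carnot_group R s) :
  exists eta0 : R, 0 < eta0 /\
  forall eta : R, 0 < eta < eta0 ->
  forall lambda : R, 0 < lambda ->
  exists C : R, 0 < C /\
  forall (p1 p2 p3 p4 p5 : 'rV[R]_(cdim G)) (l : R), 0 < l ->
    let p := [:: p1; p2; p3; p4; p5] in
    (forall i j : 'I_5, i != j ->
       lambda * l <= hs_dist eta p`_i p`_j <= l) ->
    \sum_(1 <= k < s.+1)
      sup [set qdist_set eta (qproj k (hline p3 p4 t))
                 [set qproj k q | q in hsegment p1 p5] ^+ (2 * k)
               / l ^+ (2 * k - 1)
          | t in [set t : R | 0 <= t <= 1]]
    <= C * \sum_(2 <= k < s.+1) excess eta k p.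
Proof.
have [eta0 eta00 convex] := cmul_dilation_convex G.
exists eta0; split => // eta eta01 lambda lambda0.
have [eta_gt0 _] := andP eta01.
have ball_convex := convex eta eta01.
have s0 : (0 < s)%N by exact: ltnW.
have [C0 [M [C00 M0 Hseg]]] := segment_deviation s0 eta_gt0 ball_convex lambda0.
have [Cu Cu0 Hpow] := hs_norm_power_uniform G eta_gt0 s M0.
(* Each of the [s] summands will be at most [Cu * C0] times the excess in [G]; the added 1 ensures
   positivity. *)
exists (s%:R * (Cu * C0) + 1); split.
  by apply: ltr_wpDl => //; rewrite !mulr_ge0.
move=> p1 p2 p3 p4 p5 l l0 p Hp.
pose d k x y := hs_norm (@layer R s G) eta (trunc k (cmul (- x) y)).
have d_tri k x y z : d k x z <= d k x y + d k y z.
  by rewrite /d -(cmul_chain x y z); exact: hs_norm_trunc_cmul.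
have excess_ge0 k : 0 <= excess eta k p.
  by rewrite excess_five; have [] := path_excess (d_tri k) p1 p2 p3 p4 p5.
(* The excess in [G] is the term k = s, which is in the range because s > 1. *)
have Delta_le : excess eta s p <= \sum_(2 <= k < s.+1) excess eta k p.
  by rewrite big_nat_recr //= lerDr sumr_ge0.
apply: (@le_trans _ _ (s%:R * (Cu * C0) * excess eta s p)); last first.
  apply: (@le_trans _ _ ((s%:R * (Cu * C0) + 1) * excess eta s p)).
    by apply: ler_wpM2r => //; rewrite lerDl.
  by apply: ler_wpM2l => //; nonneg.
have -> : s%:R * (Cu * C0) * excess eta s p =
    \sum_(1 <= k < s.+1) Cu * C0 * excess eta s p.
  by rewrite sumr_const_nat subn1 /= -[RHS]mulr_natl -[LHS]mulrA.
rewrite !big_nat; apply: ler_sum => k /andP[k0]; rewrite ltnS => ks.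
apply: ge_sup.
  exists (qdist_set eta (qproj k (hline p3 p4 0))
    [set qproj k q | q in hsegment p1 p5] ^+ (2 * k) / l ^+ (2 * k - 1)).
  by exists 0 => //=; rewrite lexx ler01.
move=> _ [t /= t01 <-].
pose N := hs_norm (@layer R s G) eta.
pose g := cmul (- p1) p3; pose h := cmul (- p3) p4; pose f := cmul (- p4) p5.
have ghE : cmul g h = cmul (- p1) p4 by exact: cmul_chain.
have hfE : cmul h f = cmul (- p3) p5 by exact: cmul_chain.
have ghfE : cmul g (cmul h f) = cmul (- p1) p5 by rewrite hfE; exact: cmul_chain.
have dE x y : d s x y = N (cmul (- x) y) by rewrite /d trunc_step.
have gl : lambda * l <= N g <= l by exact: (Hp (@Ordinal 5 0 isT) (@Ordinal 5 2 isT)).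
have hl : lambda * l <= N h <= l by exact: (Hp (@Ordinal 5 2 isT) (@Ordinal 5 3 isT)).
have fl : lambda * l <= N f <= l by exact: (Hp (@Ordinal 5 3 isT) (@Ordinal 5 4 isT)).
have [_ ghD hfD] := path_excess (d_tri s) p1 p2 p3 p4 p5.
rewrite -[X in _ <= X](@excess_five _ _ _ eta) -/p !dE -ghE in ghD.
rewrite -[X in _ <= X](@excess_five _ _ _ eta) -/p !dE -hfE in hfD.
have li0 : 0 < l^-1 by rewrite invr_gt0.
(* Dilating by 1/l brings the increments into the range from [lambda] to 1 and divides the excess by
   [l]. *)
pose sc x := dilation (@layer R s G) l^-1 x.
have Nsc x : N (sc x) = N x / l.
  by rewrite [RHS]mulrC -(hs_norm_dilation (@layer_gt0 R s G) eta_gt0 x li0).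
have sc_cmul x y : cmul (sc x) (sc y) = sc (cmul x y) by rewrite /sc dilation_cmul.
have norm_itv x : lambda * l <= N x <= l -> lambda <= N (sc x) <= 1.
  by rewrite Nsc ler_pdivlMr// ler_pdivrMr// mul1r.
have [||||||r r01] := Hseg (sc g) (sc h) (sc f) (excess eta s p / l) t.
- exact: norm_itv.
- exact: norm_itv.
- exact: norm_itv.
- by rewrite sc_cmul -!/(N _) !Nsc -mulrDl -mulrBl ler_pM2r.
- by rewrite sc_cmul -!/(N _) !Nsc -mulrDl -mulrBl ler_pM2r.
- exact: t01.
pose z := cmul (- hline p1 p5 r) (hline p3 p4 t).
set zs := cmul _ _ => /= zsM.
have hsc u x : u *: horizontal (sc x) = sc (dilation (@layer R s G) u (horizontal x)).
  by rewrite /sc dilation_horizontal dilationZ horizontal_dilation dilation_horizontal.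
(* The base point p1 cancels in [z], and dilations are homomorphisms. *)
have zsE : zs = sc z.
  rewrite /zs (sc_cmul h) (sc_cmul g) ghfE !hsc -[- sc _]dilationN (sc_cmul g).
  by rewrite sc_cmul /z /hline oppr_cmul -cmulA (cmulA (- p1)).
move: zsM; rewrite zsE => -[zM zE].
(* The infimum over the segment is bounded by its point of parameter [r]. *)
have qle : qdist_set eta (qproj k (hline p3 p4 t))
    [set qproj k q | q in hsegment p1 p5] <= N (trunc k z).
  apply: ge_inf.
    exists 0 => _ [_ [q _ <-] <-]; rewrite qdist_qproj.
    by apply: hs_norm_ge0 => //; exact: layer_gt0.
  exists (qproj k (hline p1 p5 r)); first by exists (hline p1 p5 r) => //; exists r.
  by rewrite qdist_qproj -(hs_normN eta_gt0) -truncN oppr_cmul opprK.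
have q0 : 0 <= qdist_set eta (qproj k (hline p3 p4 t))
    [set qproj k q | q in hsegment p1 p5].
  apply: lb_le_inf.
    exists (qdist eta (qproj k (hline p3 p4 t)) (qproj k (hline p1 p5 r))).
    by exists (qproj k (hline p1 p5 r)) => //; exists (hline p1 p5 r) => //; exists r.
  move=> _ [_ [q _ <-] <-]; rewrite qdist_qproj.
  by apply: hs_norm_ge0 => //; exact: layer_gt0.
apply: (@le_trans _ _ (N (trunc k z) ^+ (2 * k) / l ^+ (2 * k - 1))).
  rewrite ler_pM2r ?invr_gt0 ?exprn_gt0//.
  by apply: lerXn2r; rewrite ?nnegrE// (le_trans q0).
have -> : N (trunc k z) = l * N (trunc k (sc z)).
  by rewrite /sc trunc_dilation -/(sc _) Nsc mulrC divfK// gt_eqF.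
(* As k > 0, the subtraction is exact and one factor [l] is left over; it cancels the 1/l in the
   rescaled excess. *)
have l2k : l ^+ (2 * k) = l * l ^+ (2 * k - 1).
  by rewrite -exprS subn1 prednK// muln_gt0.
rewrite exprMn l2k mulrAC mulfK ?gt_eqF ?exprn_gt0//.
have := Hpow k (sc z); rewrite k0 ks => /(_ isT zM) Nz.
apply: le_trans (ler_wpM2l (ltW l0) Nz) _.
apply: (@le_trans _ _ (l * (Cu * (C0 * (excess eta s p / l))))).
  by apply: ler_wpM2l; [exact: ltW | exact: ler_wpM2l].
rewrite [leLHS](_ : _ = Cu * C0 * excess eta s p)//.
by field; exact: lt0r_neq0.
Qed.
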